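(* Let $(\psi,\phi)$ be one of the following three types of pairs of functions: Type 1: $(\psi,\phi)=(e^t,t)$; Type 2: $(\psi,\phi)=(t,\ln t)$; Type 3: $(\psi,\phi)=(L_{m_*}(t),L_{n_*}(t))$ with integers $n_*>m_*\ge 1$. Let $\epsilon=1$ for Type 1, and $\epsilon=0$ for Types 2 and 3. Assume there is $T_f\ge 0$ such that $f$ is continuous on $[T_f,\infty)$, and that $f$ admits the asymptotic expansion $$f(t)\sim\sum_{k=1}^\infty p_k(\phi(t))\psi(t)^{-\mu_k},$$ where each $p_k:\mathbb R\to\mathbb R^n$ is a polynomial, $(\mu_k)_{k=1}^\infty$ is a divergent, strictly increasing sequence of positive numbers, and the set $\mathcal S=\{\mu_k:k\in\mathbb N\}$ satisfies: (a) $x+y\in\mathcal S$ for all $x,y\in\mathcal S$; (b) in case of Type 1, $\mathcal S$ contains all eigenvalues of $A$; (c) in case of Type 2, $x+1\in\mathcal S$ for all $x\in\mathcal S$. Let $T_0\ge 0$ and let $y\in C^1((T_0,\infty),\mathbb R^n)$ be a solution of $y'=-Ay+G(y)+f(t)$ on $(T_0,\infty)$ with $y(t)\to 0$ as $t\to\infty$. Then there exist unique polynomials $q_k:\mathbb R\to\mathbb R^n$, $k\in\mathbb N$, such that $$y(t)\sim\sum_{k=1}^\infty q_k(\phi(t))\psi(t)^{-\mu_k}.$$ Moreover, the polynomials $q_k$ solve, on $\mathbb R$, the equations $$Aq_1+\epsilon(q_1'-\mu_1q_1)=p_1,$$ and, for $k\ge 2$, $$Aq_k+\epsilon(q_k'-\mu_kq_k)=\sum_{m\ge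 2}\ \sum_{\mu_{j_1}+\mu_{j_2}+\cdots+\mu_{j_m}=\mu_k}\mathcal G_m(q_{j_1},q_{j_2},\ldots,q_{j_m})+p_k+\chi_k,$$ where the inner sum is over all indices $j_1,\ldots,j_m\ge 1$ satisfying the indicated equality (an empty sum is zero), and $\chi_k:\mathbb R\to\mathbb R^n$ is the polynomial defined by $\chi_k=0$ in cases of Types 1 and 3, and, in case of Type 2, by $$\chi_k=\begin{cases}\mu_\lambda q_\lambda-q_\lambda',&\text{if there exists an integer }\lambda\in[1,k-1]\text{ such that }\mu_\lambda+1=\mu_k,\\ 0,&\text{otherwise.}\end{cases}$$
   Context: Notation: $\mathbb N=\{1,2,\ldots\}$, $|\cdot|$ is the Euclidean norm on $\mathbb R^n$, $n\in\mathbb N$ fixed. For functions of $t$, $g(t)=\mathcal O(h(t))$ means there are $T,C>0$ with $|g(t)|\le Ch(t)$ for all $t\ge T$. Iterated logarithms: $L_0(t)=t$ and $L_{m+1}(t)=\ln(L_m(t))$, defined for $t$ sufficiently large. Standing assumptions on $y'=-Ay+G(y)+f(t)$ in $\mathbb R^n$: $A$ is a constant real $n\times n$ matrix which is diagonalizable with positive eigenvalues (i.e. $A=S^{-1}A_0S$ with $S$ invertible and $A_0$ diagonal with positive entries). $G:\mathbb R^n\to\mathbb R^n$ is locally Lipschitz, and there are functions $G_m:\mathbb R^n\to\mathbb R^n$, $m\ge 2$, each a homogeneous polynomial of degree $m$, such that for every $N\ge 2$ there exists $\delta>0$ with $|G(y)-\sum_{m=2}^NG_m(y)|=\mathcal O(|y|^{N+\delta})$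 as $y\to 0$. For each $m\ge 2$, $\mathcal G_m$ is a (fixed) $m$-linear mapping from $(\mathbb R^n)^m$ to $\mathbb R^n$ with $G_m(y)=\mathcal G_m(y,y,\ldots,y)$ for all $y\in\mathbb R^n$. The forcing $f$ is a function from $(0,\infty)$ to $\mathbb R^n$. Asymptotic expansion: for $g:(T',\infty)\to\mathbb R^n$, polynomials $p_k:\mathbb R\to\mathbb R^n$ and a divergent, strictly increasing sequence $(\gamma_k)_{k=1}^\infty$ of positive numbers, $g(t)\sim\sum_{k=1}^\infty p_k(\phi(t))\psi(t)^{-\gamma_k}$ means that for every $N\ge 1$ there exists $\mu>\gamma_N$ such that $|g(t)-\sum_{k=1}^Np_k(\phi(t))\psi(t)^{-\gamma_k}|=\mathcal O(\psi(t)^{-\mu})$. *)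

(* Defs.v *)
From HB Require Import structures.
From mathcomp Require Import all_boot all_order all_algebra.
From mathcomp Require Import all_classical all_reals all_analysis.
(* Not imported: the notations of mpoly clash with those of the analysis
   library. *)
From mathcomp Require mpoly.

Set Implicit Arguments.
Unset Strict Implicit.
Unset Printing Implicit Defensive.

Import Order.TTheory GRing.Theory Num.Theory.
Import numFieldNormedType.Exports.

Local Open Scope classical_set_scope.
Local Open Scope ring_scope.

(* The library norm on 'cV[R]_n is the sup norm; it serves only for the
   topology, for derivatives and for the local Lipschitz condition. *)
Definition enorm (R : realType) (n : nat) (v : 'cV[R]_n) : R :=
  Num.sqrt (\sum_i v i 0 ^+ 2).

Definition big_O (R : realType) (n : nat) (g : R -> 'cV[R]_n) (h : R -> R) :=
  exists T C : R,
    [/\ 0 < T, 0 < C & forall t, T <= t -> enorm (g t) <= C * h t].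

(* Polynomials R -> R^n are columns of polynomials. *)
Definition vpoly (R : realType) (n : nat) := 'cV[{poly R}]_n.

Definition veval (R : realType) (n : nat) (p : vpoly R n) (x : R) : 'cV[R]_n :=
  \col_i (p i 0).[x].

Definition vderiv (R : realType) (n : nat) (p : vpoly R n) : vpoly R n :=
  \col_i deriv (p i 0).

(* ln is extended by 0 to nonpositive reals; this is invisible for large t. *)
Definition iterlog (R : realType) (m : nat) (t : R) : R := iter m (@ln R) t.

Inductive pair_type :=
  | Type1
  | Type2
  | Type3 (ms ns : nat) of (1 <= ms < ns)%N.

Definition psi (R : realType) (ty : pair_type) (t : R) : R :=
  match ty with
  | Type1 => expR t
  | Type2 => t
  | Type3 ms _ _ => iterlog ms t
  end.

Definition phi (R : realType) (ty : pair_type) (t : R) : R :=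
  match ty with
  | Type1 => t
  | Type2 => ln t
  | Type3 _ ns _ => iterlog ns t
  end.

Definition epsilon (R : realType) (ty : pair_type) : R :=
  if ty is Type1 then 1 else 0.

(* All sequences (exponents and polynomials) are indexed from 0: p k, gamma k
   stand for the usual p_{k+1}, gamma_{k+1}. *)
Definition asymp_expansion (R : realType) (n : nat) (g : R -> 'cV[R]_n)
    (p : nat -> vpoly R n) (gamma : nat -> R) (ph ps : R -> R) :=
  forall N : nat, exists2 nu : R, gamma N < nu &
    big_O (fun t => g t -
             \sum_(k < N.+1) (ps t `^ (- gamma k)) *: veval (p k) (ph t))
          (fun t => ps t `^ (- nu)).

Definition diag_pos_eigen (R : realType) (n : nat) (A : 'M[R]_n) :=
  exists (S : 'M[R]_n) (d : 'rV[R]_n),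
    [/\ S \in unitmx, forall i, 0 < d 0 i & A = invmx S *m diag_mx d *m S].

Definition locally_lipschitz (R : realType) (n : nat)
    (G : 'cV[R]_n -> 'cV[R]_n) :=
  forall y : 'cV[R]_n, exists2 U, nbhs y U & [lipschitz G x | x in U].

(* The condition on p is mpoly's own definition of p \is m.-homog. *)
Definition homog_poly_map (R : realType) (n m : nat)
    (P : 'cV[R]_n -> 'cV[R]_n) :=
  forall i : 'I_n, exists2 p : mpoly.mpoly n R,
    all (fun mon => mpoly.mdeg mon == m) (mpoly.msupp p) &
    forall y, P y i 0 = mpoly.meval (fun j => y j 0) p.

Definition multilinear (R : realType) (n m : nat)
    (M : {ffun 'I_m -> 'cV[R]_n} -> 'cV[R]_n) :=
  forall (v : {ffun 'I_m -> 'cV[R]_n}) (i : 'I_m) (a : R) (x y : 'cV[R]_n),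
    let upd z := [ffun j => if j == i then z else v j] in
    M (upd (a *: x + y)) = a *: M (upd x) + M (upd y).

Definition power_expansion_at0 (R : realType) (n : nat)
    (G : 'cV[R]_n -> 'cV[R]_n) (Gm : nat -> 'cV[R]_n -> 'cV[R]_n) :=
  forall N : nat, (2 <= N)%N -> exists2 delta : R, 0 < delta &
    exists2 C : R, 0 < C & \forall y \near (0 : 'cV[R]_n)^',
      enorm (G y - \sum_(2 <= m < N.+1) Gm m y)
        <= C * enorm y `^ (N%:R + delta).

Definition C1_on (R : realType) (n : nat) (y : R -> 'cV[R]_n) (D : set R) :=
  forall t, D t -> derivable y t 1 /\ {for t, continuous (derive1 y)}.

(* The exponent l with mu l + 1 = mu k, if any, is unique since mu is
   strictly increasing. *)
Definition chi (R : realType) (n : nat) (ty : pair_type) (mu : nat -> R)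
    (q : nat -> vpoly R n) (k : nat) : vpoly R n :=
  if ty is Type2 then
    if [pick l : 'I_k | mu l + 1 == mu k] is Some l
    then (mu l)%:P *: q l - vderiv (q l)
    else 0
  else 0.

(* Both finitely supported sums are genuinely finite when mu is positive,
   strictly increasing and divergent. *)
Definition resonant_sum (R : realType) (n : nat) (mu : nat -> R)
    (Gml : forall m : nat, {ffun 'I_m -> 'cV[R]_n} -> 'cV[R]_n)
    (q : nat -> vpoly R n) (k : nat) (z : R) : 'cV[R]_n :=
  \sum_(m \in [set m : nat | (2 <= m)%N])
   \sum_(j \in [set j : {ffun 'I_m -> nat} | \sum_i mu (j i) = mu k])
     Gml m [ffun i => veval (q (j i)) z].

(* Main.v *)
Require Import Defs.
From mathcomp Require Import all_boot all_order all_algebra.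
From mathcomp Require Import all_classical all_reals all_analysis.
From mathcomp Require Import ring lra.
Set Implicit Arguments.
Unset Strict Implicit.
Unset Printing Implicit Defensive.
Import Order.TTheory GRing.Theory Num.Theory.
Import numFieldNormedType.Exports.
Local Open Scope classical_set_scope.
Local Open Scope ring_scope.

(** The expansion is built term by term. Put [l = ln psi], so that the powers of
    [psi] are exponentials of [l]; for the three types, [l] and [phi] have the
    same derivative [eps + eps2 / psi] up to terms beyond all orders, and
    polynomials in [phi] grow more slowly than every power of [psi] (lemma
    [time_scale_pair]).

    First, [y] decays like the leading exponent [mu 0], up to an arbitrarily
    small loss (lemma [initial_decay]): [A] is diagonalizable with positive
    eigenvalues, [G] is quadratic at the origin, and an energy estimate compares
    [|S y|^2] with a power of [psi].

    Suppose then that [N] terms have been found, with remainder [v]. Since the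
    exponents are closed under addition, [mu N <= mu (N - 1) + mu 0]; hence every
    product which contains [v] and one more factor decays faster than [mu N],
    and expanding the multilinear mappings over the terms of [y] gives [G y] up
    to that order, with resonant sums as coefficients (lemma
    [nonlinear_expansion]). The derivatives of the known terms produce the
    operator [q' - mu q] when [eps = 1], and terms whose exponent is shifted by
    one, that is [chi], when [eps2 = 1]. The equations of the known coefficients
    cancel all orders below [mu N], and [v' = - A v + P(phi) psi^(- mu N)] up to
    faster decay, where [P] is the right-hand side of the equation for [q N]
    (lemma [remainder_forcing]).

    In the coordinates which diagonalize [A], these are scalar linear equations,
    which determine the next term (lemma [scalar_linear_step]). If the damping
    [d] is larger than [eps * mu N], a polynomial solves the equation of the
    coefficient, and the rest inherits the decay of the forcing by comparison
    with a barrier. If not, [psi] is the exponential and the rest may contain a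
    multiple of [exp (- d t)]. As [d] is an exponent, either [d = mu N], and
    that multiple is absorbed in the constant term of the coefficient, or [d] is
    an earlier exponent, and the decay already known of [v] excludes it. All
    limits and bounds come from the monotonicity of suitable functions.

    Since the coefficients may contain constants that depend on [y], the
    sequence is obtained by dependent choice. Uniqueness holds because a
    nonzero polynomial in [phi] does not tend to zero. *)

(** * Decay classes on the scale of powers of psi *)

Section Decay.
Variables (R : realType) (l : R -> R).

(** With [l = ln psi], [expR (- (a * l t))] is [psi t] to the power [- a]. *)
Definition decays (a : R) (g : R -> R) :=
  exists C : R, \forall t \near +oo, `|g t| <= C * expR (- (a * l t)).

(** The class of the remainders of an expansion through order [a]: some decay
    rate beyond [a] is reached, but no particular one matters. *)
Definition decays_gt (a : R) (g : R -> R) := exists2 nu, a < nu & decays nu g.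

(** The class of the terms [P.[phi t] * psi t `^ (- a)], in which the unbounded
    factor [P.[phi t]] costs an arbitrarily small part of the rate [a]. *)
Definition decays_ge (a : R) (g : R -> R) := forall nu, nu < a -> decays nu g.

Hypothesis l_pinfty : l t @[t --> +oo] --> +oo.

Lemma pinfty_near_ge (M : R) : \forall t \near +oo, M <= l t.
Proof. by apply: (l_pinfty (nbhs_pinfty_ge _)); exact: num_real. Qed.

Lemma decays_near a g h : (\forall t \near +oo, g t = h t) ->
  decays a g -> decays a h.
Proof.
move=> gh [C HC]; exists C; near=> t.
suff: `|g t| <= C * expR (- (a * l t)).
  by have -> : g t = h t by near: t.
by near: t.
Unshelve. all: by end_near. Qed.

Lemma decays_le a g h : (\forall t \near +oo, `|h t| <= `|g t|) ->
  decays a g -> decays a h.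
Proof.
move=> hg [C HC]; exists C; near=> t.
apply: (@le_trans _ _ `|g t|); near: t => //.
Unshelve. all: by end_near. Qed.

Lemma decays0 a : decays a (fun=> 0).
Proof. by exists 0; near=> t; rewrite normr0 mul0r.
Unshelve. all: by end_near. Qed.

Lemma decaysD a g h : decays a g -> decays a h -> decays a (fun t => g t + h t).
Proof.
move=> [C HC] [D HD]; exists (C + D); near=> t.
by rewrite mulrDl; apply: (le_trans (ler_normD _ _)); apply: lerD; near: t.
Unshelve. all: by end_near. Qed.

Lemma decaysM a b g h : decays a g -> decays b h ->
  decays (a + b) (fun t => g t * h t).
Proof.
move=> [C HC] [D HD]; exists (C * D); near=> t.
rewrite mulrDl opprD expRD mulrACA normrM.
by apply: ler_pM => //; near: t.
Unshelve. all: by end_near. Qed.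

Lemma decays_const c : decays 0 (fun=> c).
Proof. by exists `|c|; near=> t; rewrite mul0r oppr0 expR0 mulr1.
Unshelve. all: by end_near. Qed.

Lemma decays_exp a : decays a (fun t => expR (- (a * l t))).
Proof. by exists 1; near=> t; rewrite mul1r ger0_norm ?expR_ge0.
Unshelve. all: by end_near. Qed.

Lemma decays_weaken a b g : a <= b -> decays b g -> decays a g.
Proof.
move=> ab [C HC]; exists `|C|; near=> t.
have l0 : 0 <= l t by near: t; exact: pinfty_near_ge.
have : `|g t| <= C * expR (- (b * l t)) by near: t.
move=> /le_trans; apply.
apply: (@le_trans _ _ (`|C| * expR (- (b * l t)))).
  by rewrite ler_wpM2r ?expR_ge0 ?ler_norm.
by rewrite ler_wpM2l // ler_expR lerN2 ler_wpM2r.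
Unshelve. all: by end_near. Qed.

Lemma decays_cvg0 a g : 0 < a -> decays a g -> g t @[t --> +oo] --> 0.
Proof.
move=> a0 [C HC].
have key : C * expR (- (a * l t)) @[t --> +oo] --> (0 : R).
  rewrite -(mulr0 C); apply: cvgM; first exact: cvg_cst.
  apply: (cvg_comp (fun t => a * l t) (fun x => expR (- x)) _ (@cvgr_expR R)).
  exact: gt0_cvgMry.
apply/norm_cvg0P; apply: (@squeeze_cvgr _ _ _ _ (fun=> 0) _ _ _ _ _ key).
- by near=> t; rewrite normr_ge0 /=; near: t.
- exact: cvg_cst.
Unshelve. all: by end_near. Qed.

Lemma decays_gt_near a g h : (\forall t \near +oo, g t = h t) ->
  decays_gt a g -> decays_gt a h.
Proof. by move=> gh [nu ? /(decays_near gh)]; exists nu. Qed.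

Lemma decays_gt0 a : decays_gt a (fun=> 0).
Proof. by exists (a + 1); [rewrite ltrDl|exact: decays0]. Qed.

Lemma decays_gtD a g h : decays_gt a g -> decays_gt a h ->
  decays_gt a (fun t => g t + h t).
Proof.
move=> [nu nua gO] [xi xia hO]; exists (Num.min nu xi).
  by rewrite lt_min nua.
by apply: decaysD; [move: gO|move: hO]; apply: decays_weaken;
  rewrite ge_min lexx ?orbT.
Qed.

Lemma decays_gt_weaken a b g : a <= b -> decays_gt b g -> decays_gt a g.
Proof. by move=> ab [nu /(le_lt_trans ab) ? ?]; exists nu. Qed.

Lemma decays_gtZ a c g : decays_gt a g -> decays_gt a (fun t => c * g t).
Proof.
move=> [nu nua gO]; exists nu => //.
by rewrite -(add0r nu); apply: decaysM => //; exact: decays_const.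
Qed.

Lemma decays_gtN a g : decays_gt a g -> decays_gt a (fun t => - g t).
Proof.
move=> /(decays_gtZ (-1)); apply: decays_gt_near.
by near=> t; rewrite mulN1r.
Unshelve. all: by end_near. Qed.

Lemma decays_gtB a g h : decays_gt a g -> decays_gt a h ->
  decays_gt a (fun t => g t - h t).
Proof. by move=> ga /decays_gtN; apply: decays_gtD. Qed.

Lemma decays_gt_sum a (I : Type) (r : seq I) (P : pred I) (F : I -> R -> R) :
  (forall i, P i -> decays_gt a (F i)) ->
  decays_gt a (fun t => \sum_(i <- r | P i) F i t).
Proof.
move=> FO; elim: r => [|i r IH].
  by apply: (decays_gt_near _ (decays_gt0 a)); near=> t; rewrite big_nil.
case Pi: (P i).
  apply: (decays_gt_near _ (decays_gtD (FO i Pi) IH)).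
  by near=> t; rewrite big_cons Pi.
by apply: (decays_gt_near _ IH); near=> t; rewrite big_cons Pi.
Unshelve. all: by end_near. Qed.

Lemma decays_ge_near a g h : (\forall t \near +oo, g t = h t) ->
  decays_ge a g -> decays_ge a h.
Proof. by move=> gh gO nu /gO; exact: decays_near. Qed.

Lemma decays_geW a g : decays a g -> decays_ge a g.
Proof. by move=> gO nu /ltW nua; exact: decays_weaken gO. Qed.

Lemma decays_gt_ge a g : decays_gt a g -> decays_ge a g.
Proof.
by move=> [nu anu gO] xi xia; apply: decays_weaken gO; apply/ltW/(lt_trans xia).
Qed.

Lemma decays_ge_gt a b g : a < b -> decays_ge b g -> decays_gt a g.
Proof.
by move=> ab gO; exists ((a + b) / 2); [lra|apply: gO; lra].
Qed.

Lemma decays_ge_weaken a b g : a <= b -> decays_ge b g -> decays_ge a g.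
Proof. by move=> ab gO nu /lt_le_trans/(_ ab)/gO. Qed.

Lemma decays_geD a g h : decays_ge a g -> decays_ge a h ->
  decays_ge a (fun t => g t + h t).
Proof. by move=> gO hO nu nua; apply: decaysD; [exact: gO|exact: hO]. Qed.

Lemma decays_geM a b g h : decays_ge a g -> decays_ge b h ->
  decays_ge (a + b) (fun t => g t * h t).
Proof.
move=> gO hO nu nuab.
have -> : nu = (a - (a + b - nu) / 2) + (b - (a + b - nu) / 2) by field.
by apply: decaysM; [apply: gO|apply: hO]; lra.
Qed.

(** The margin of the first factor pays for the small loss of the second. *)
Lemma decays_gtM a b g h : decays_gt a g -> decays_ge b h ->
  decays_gt (a + b) (fun t => g t * h t).
Proof.
move=> [nu anu gO] hO; exists ((nu + a) / 2 + b); first lra.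
have -> : (nu + a) / 2 + b = nu + (b - (nu - a) / 2) by field.
by apply: decaysM => //; apply: hO; lra.
Qed.

Lemma decays_ge_sum a (I : Type) (r : seq I) (P : pred I) (F : I -> R -> R) :
  (forall i, P i -> decays_ge a (F i)) ->
  decays_ge a (fun t => \sum_(i <- r | P i) F i t).
Proof.
move=> FO; elim: r => [|i r IH].
  apply: (decays_ge_near _ (decays_geW (decays0 a))).
  by near=> t; rewrite big_nil.
case Pi: (P i).
  apply: (decays_ge_near _ (decays_geD (FO i Pi) IH)).
  by near=> t; rewrite big_cons Pi.
by apply: (decays_ge_near _ IH); near=> t; rewrite big_cons Pi.
Unshelve. all: by end_near. Qed.

Lemma decays_ge_prod a (I : Type) (r : seq I) (P : pred I) (F : I -> R -> R) :
  (forall i, P i -> decays_ge a (F i)) ->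
  decays_ge (\sum_(i <- r | P i) a) (fun t => \prod_(i <- r | P i) F i t).
Proof.
move=> FO; elim: r => [|i r IH].
  rewrite big_nil.
  apply: (decays_ge_near _ (decays_geW (decays_const 1))).
  by near=> t; rewrite big_nil.
rewrite big_cons; case Pi: (P i).
  apply: (decays_ge_near _ (decays_geM (FO i Pi) IH)).
  by near=> t; rewrite big_cons Pi.
by apply: (decays_ge_near _ IH); near=> t; rewrite big_cons Pi.
Unshelve. all: by end_near. Qed.

End Decay.

(** * Derivatives and differential inequalities near infinity *)

Lemma near_pinftyP (R : realType) (P : R -> Prop) :
  (\forall t \near +oo, P t) -> exists T, forall t, T <= t -> P t.
Proof.
move=> [M [_ MP]]; exists (M + 1) => t Mt.
by apply: MP; rewrite (lt_le_trans _ Mt) // ltrDl.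
Qed.

Section RealDerivatives.
Variable R : realType.
Implicit Types (f g : R -> R) (t a b c : R).

Lemma is_derive_add f g t a b : is_derive t (1 : R) f a -> is_derive t (1 : R) g b ->
  is_derive t (1 : R) (fun s => f s + g s) (a + b).
Proof. by move=> fa gb; exact: is_deriveD. Qed.

Lemma is_derive_sub f g t a b : is_derive t (1 : R) f a -> is_derive t (1 : R) g b ->
  is_derive t (1 : R) (fun s => f s - g s) (a - b).
Proof. by move=> fa gb; exact: is_deriveB. Qed.

Lemma is_derive_mul f g t a b : is_derive t (1 : R) f a -> is_derive t (1 : R) g b ->
  is_derive t (1 : R) (fun s => f s * g s) (a * g t + f t * b).
Proof.
move=> fa gb; have := is_deriveM fa gb; move/is_derive_eq; apply.
by rewrite /GRing.scale /= addrC (mulrC (g t)).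
Qed.

Lemma is_derive_scale f c t a : is_derive t (1 : R) f a ->
  is_derive t (1 : R) (fun s => c * f s) (c * a).
Proof. by move=> fa; exact: is_deriveZ. Qed.

Lemma is_derive_lsum (I : Type) (r : seq I) (P : pred I) (F : I -> R -> R)
    (dF : I -> R) t : (forall i, is_derive t (1 : R) (F i) (dF i)) ->
  is_derive t (1 : R) (fun s => \sum_(i <- r | P i) F i s) (\sum_(i <- r | P i) dF i).
Proof.
move=> FdF; elim: r => [|i r IH].
  rewrite big_nil (_ : (fun _ => _) = cst 0); last first.
    by apply/funext => s; rewrite big_nil.
  exact: is_derive_cst.
rewrite big_cons; case Pi: (P i); last first.
  rewrite (_ : (fun _ => _) = fun s => \sum_(j <- r | P j) F j s) //.
  by apply/funext => s; rewrite big_cons Pi.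
rewrite (_ : (fun _ => _) = fun s => F i s + \sum_(j <- r | P j) F j s).
  exact: is_derive_add.
by apply/funext => s; rewrite big_cons Pi.
Qed.

Lemma is_derive_expMl f c t a : is_derive t (1 : R) f a ->
  is_derive t (1 : R) (fun s => expR (c * f s)) (c * a * expR (c * f t)).
Proof.
move=> fa; have fc := is_derive_scale c fa.
have := is_derive1_comp (g := fun s => c * f s) (is_derive_expR (c * f t)) fc.
by move/is_derive_eq; apply; rewrite mulrC.
Qed.

Lemma is_derive_expN f c t a : is_derive t (1 : R) f a ->
  is_derive t (1 : R) (fun s => expR (- (c * f s))) (- (c * a) * expR (- (c * f t))).
Proof.
move=> /(is_derive_expMl (- c)); rewrite !mulNr.
by congr is_derive; apply/funext => s; rewrite mulNr.
Qed.

Lemma is_derive_nonincr f (df : R -> R) (T : R) :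
  (forall t, T <= t -> is_derive t (1 : R) f (df t)) ->
  (forall t, T <= t -> df t <= 0) ->
  forall s t, T <= s -> s <= t -> f t <= f s.
Proof.
move=> fdf df0 s t Ts st.
have fdf' x : x \in `]s, t[%R -> is_derive x 1 f (df x).
  by rewrite in_itv /= => /andP[sx _]; apply: fdf; rewrite (le_trans Ts) // ltW.
have fc : {within `[s, t], continuous f}.
  apply: derivable_within_continuous => x; rewrite in_itv /= => /andP[sx _].
  by have := fdf x (le_trans Ts sx); move=> /@ex_derive.
have [c cst] := MVT_segment st fdf' fc.
rewrite -subr_le0 => ->; rewrite mulr_le0_ge0 ?subr_ge0 //.
by apply: df0; move: cst; rewrite in_itv /= => /andP[/(le_trans Ts)].
Qed.

(** [b] is a supersolution up to a constant: for [K >= C / eta] the function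
    [expR (d * t) * (u t - K * b t)] is nonincreasing, and it starts at a
    nonpositive value if [K] is also at least [u T / b T]. *)
Lemma barrier (d eta C : R) (u du b db : R -> R) :
  0 < eta -> 0 <= C ->
  (\forall t \near +oo, [/\ is_derive t (1 : R) u (du t), is_derive t (1 : R) b (db t),
     0 < b t, eta * b t <= db t + d * b t & du t + d * u t <= C * b t]) ->
  exists2 K, 0 <= K & \forall t \near +oo, u t <= K * b t.
Proof.
move=> eta0 C0 /near_pinftyP[T HT].
have [_ _ bT0 _ _] := HT T (lexx T).
exists (C / eta + `|u T| / b T).
  by rewrite addr_ge0 // divr_ge0 // ltW.
set K := C / eta + _.
have CK : C <= K * eta.
  rewrite /K mulrDl divfK ?gt_eqF // lerDl.
  by rewrite mulr_ge0 ?divr_ge0 // ltW.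
pose w t := expR (d * t) * (u t - K * b t).
pose dw t := d * 1 * expR (d * t) * (u t - K * b t)
   + expR (d * t) * (du t - K * db t).
have wdw t : T <= t -> is_derive t (1 : R) w (dw t).
  move=> /HT[ud bd _ _ _]; apply: is_derive_mul.
  exact: (is_derive_expMl d (is_derive_id _ _)).
have dw0 t : T <= t -> dw t <= 0.
  move=> /HT[_ _ bt Hb Hu].
  have -> : dw t = expR (d * t) *
    ((du t + d * u t) - K * (db t + d * b t)) by rewrite /dw; ring.
  rewrite mulr_ge0_le0 ?expR_ge0 // subr_le0.
  apply: (le_trans Hu); apply: (@le_trans _ _ (K * eta * b t)).
    by rewrite ler_pM2r.
  rewrite -mulrA; apply: ler_wpM2l Hb.
  by rewrite /K addr_ge0 // divr_ge0 // ltW.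
have wT : w T <= 0.
  rewrite /w mulr_ge0_le0 ?expR_ge0 // subr_le0 /K mulrDl divfK ?gt_eqF //.
  rewrite (le_trans (ler_norm _)) // lerDr mulr_ge0 // ?divr_ge0 // ltW //.
near=> t.
have Tt : T <= t by near: t; apply: nbhs_pinfty_ge; exact: num_real.
have := le_trans (is_derive_nonincr wdw dw0 (lexx T) Tt) wT.
by rewrite /w pmulr_rle0 ?expR_gt0 // subr_le0.
Unshelve. all: by end_near. Qed.

(** The damping [d] dominates the rate [nu * rho t] at which
    [expR (- (nu * l t))] decays, so that this function is a barrier for [u]
    and for [- u]. *)
Lemma linear_ode_decay (l rho : R -> R) (d nu eta : R) (u h : R -> R) :
  0 < eta ->
  (\forall t \near +oo, is_derive t (1 : R) l (rho t)) ->
  (\forall t \near +oo, eta <= d - nu * rho t) ->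
  (\forall t \near +oo, is_derive t (1 : R) u (- (d * u t) + h t)) ->
  decays l nu h -> decays l nu u.
Proof.
move=> eta0 lrho etad ud [C HC].
have C0 : 0 <= C.
  have [T /(_ T (lexx T))] := near_pinftyP HC.
  move=> /(le_trans (normr_ge0 _)).
  by rewrite pmulr_lge0 ?expR_gt0.
pose b t := expR (- (nu * l t)).
pose db t := - (nu * rho t) * expR (- (nu * l t)).
have Hb : \forall t \near +oo, eta * b t <= db t + d * b t.
  near=> t; rewrite /db -mulrDl ler_wpM2r ?expR_ge0 // addrC.
  by near: t.
have bd : \forall t \near +oo, is_derive t (1 : R) b (db t).
  by near=> t; apply: is_derive_expN; near: t.
have [K K0 HK] : exists2 K, 0 <= K & \forall t \near +oo, u t <= K * b t.
  apply: (@barrier d eta C u (fun t => - (d * u t) + h t) b db) => //.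
  near=> t; split; [by near: t|by near: t|exact: expR_gt0|by near: t|].
  rewrite addrAC addNr add0r (le_trans (ler_norm _)) //.
  by near: t.
have [K' K'0 HK'] : exists2 K, 0 <= K & \forall t \near +oo, - u t <= K * b t.
  apply: (@barrier d eta C (fun t => - u t) (fun t => - (- (d * u t) + h t)) b db) => //.
  near=> t; split; [|by near: t|exact: expR_gt0|by near: t|].
    by apply: is_deriveN; near: t.
  rewrite opprD opprK mulrN addrAC subrr add0r.
  rewrite (le_trans (ler_norm _)) // normrN.
  by near: t.
exists (K + K'); near=> t.
have bt : 0 <= b t by exact: expR_ge0.
have h1 : u t <= K * b t by near: t.
have h2 : - u t <= K' * b t by near: t.
rewrite -/(b t) ler_norml mulrDl.
have := mulr_ge0 K0 bt; have := mulr_ge0 K'0 bt.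
by move=> ? ?; apply/andP; split; lra.
Unshelve. all: by end_near. Qed.

(** Adding [C / delta * expR (- (delta * t))] to [g] makes it nonincreasing and
    subtracting it makes [g] nondecreasing; the limit [c] is squeezed between
    the two functions, so no integral is needed. *)
Lemma integrable_derivative_limit (delta : R) (g k : R -> R) : 0 < delta ->
  (\forall t \near +oo, is_derive t (1 : R) g (k t)) -> decays id delta k ->
  exists c, decays id delta (fun t => g t - c).
Proof.
move=> d0 gk [C HC].
have /near_pinftyP[T HT] : \forall t \near +oo, is_derive t (1 : R) g (k t) /\
    `|k t| <= C * expR (- (delta * t)).
  by near=> t; split; near: t.
have C0 : 0 <= C.
  have [_ /(le_trans (normr_ge0 _))] := HT T (lexx T).
  by rewrite pmulr_lge0 ?expR_gt0.
pose b t := C / delta * expR (- (delta * t)).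
have b0 t : 0 <= b t by rewrite mulr_ge0 ?expR_ge0 // divr_ge0 // ltW.
have bd t : is_derive t (1 : R) b (- (C * expR (- (delta * t)))).
  have := is_derive_scale (C / delta)
    (is_derive_expN delta (is_derive_id t (1 : R))).
  move/is_derive_eq; apply; field.
  by rewrite gt_eqF.
have up s t : T <= s -> s <= t -> g t + b t <= g s + b s.
  apply: (@is_derive_nonincr (fun t => g t + b t)
    (fun t => k t + - (C * expR (- (delta * t))))).
    by move=> x /HT[gx _]; exact: is_derive_add.
  by move=> x /HT[_ kx]; rewrite subr_le0 (le_trans (ler_norm _)).
have dn s t : T <= s -> s <= t -> g s - b s <= g t - b t.
  move=> Ts st; rewrite -lerN2.
  apply: (@is_derive_nonincr (fun t => - (g t - b t))
    (fun t => - (k t - - (C * expR (- (delta * t))))) T) => //.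
    by move=> x /HT[gx _]; apply: is_deriveN; exact: is_derive_sub.
  move=> x /HT[_]; rewrite ler_norml => /andP[kx _].
  by rewrite opprK oppr_le0 -(opprK (C * _)) subr_ge0.
pose E := [set g t + b t | t in [set t | T <= t]].
have Elb t : T <= t -> lbound E (g t - b t).
  move=> Tt _ [s /= Ts <-]; have [st|/ltW ts] := leP s t.
    by rewrite (le_trans _ (up _ _ Ts st)) // lerD2l (le_trans _ (b0 t)) // oppr_le0.
  by rewrite (le_trans (dn _ _ Tt ts)) // lerD2l (le_trans _ (b0 s)) // oppr_le0.
exists (inf E), (C / delta); near=> t.
have Tt : T <= t by near: t; apply: nbhs_pinfty_ge; exact: num_real.
have h1 : inf E <= g t + b t.
  by apply: ge_inf; [exists (g t - b t); exact: Elb|exists t].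
have h2 : g t - b t <= inf E.
  by apply: lb_le_inf; [exists (g t + b t), t|exact: Elb].
rewrite -/(b t) ler_norml; apply/andP; split; lra.
Unshelve. all: by end_near. Qed.

End RealDerivatives.

(** * The pairs of functions (psi, phi) *)

Section TimeScale.
Variables (R : realType).
Implicit Types (lam phi : R -> R).

(** What the proof uses of [lam = ln psi] and [phi]. Both derivatives agree
    beyond all orders with [eps + eps2 / psi], where [(eps, eps2)] is [(1, 0)],
    [(0, 1)], [(0, 0)] for the three types: [eps] produces the operator
    [Q^`() - mu *: Q] in the equations of the coefficients, and [eps2] shifts
    the exponent by one, which produces [chi]. When [eps = 1], the equation is
    integrated against the exponential of [t], which must then be an exact
    power of [psi]: hence [lam = id]. *)
Record time_scale lam phi (eps eps2 : R) : Prop := TimeScale {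
  ts_lam : lam t @[t --> +oo] --> +oo;
  ts_phi : phi t @[t --> +oo] --> +oo;
  ts_phi_le : \forall t \near +oo, phi t <= lam t;
  ts_dlam : exists2 rho : R -> R,
    \forall t \near +oo, is_derive t (1 : R) lam (rho t) &
    forall a, decays_gt lam a (fun t => rho t - (eps + eps2 * expR (- lam t)));
  ts_dphi : exists2 sigma : R -> R,
    \forall t \near +oo, is_derive t (1 : R) phi (sigma t) &
    forall a,
      decays_gt lam a (fun t => sigma t - (eps + eps2 * expR (- lam t)));
  ts_eps : eps = 0 \/ [/\ eps = 1, eps2 = 0 & lam = id] }.

(** Use [phi <= lam] and [lam * delta <= expR (lam * delta)]. *)
Lemma time_scale_phi_decay lam phi eps eps2 : time_scale lam phi eps eps2 ->
  decays_ge lam 0 phi.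
Proof.
move=> [lamy phiy phile _ _ _] nu nu0.
exists (- nu)^-1; near=> t.
have p0 : 0 <= phi t by near: t; exact: (pinfty_near_ge phiy).
have pl : phi t <= lam t by near: t.
have l0 : 0 <= lam t by exact: le_trans pl.
rewrite ger0_norm // (le_trans pl) // -ler_pdivrMl ?invr_gt0 ?oppr_gt0 // invrK.
rewrite mulNr (le_trans _ (expR_ge1Dx _)) // lerDr //.
Unshelve. all: by end_near. Qed.

Lemma time_scale_rate lam phi eps eps2 : time_scale lam phi eps eps2 ->
  exists2 rho : R -> R,
    \forall t \near +oo, is_derive t (1 : R) lam (rho t) &
    rho t @[t --> +oo] --> eps.
Proof.
move=> ts; have lamy := ts_lam ts.
have [rho rhod rhoO] := ts_dlam ts; exists rho => //.
have h1 : decays_gt lam 0 (fun t => eps2 * expR (- (1 * lam t))).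
  by apply: decays_gtZ; exists 1 => //; exact: decays_exp.
have [z z0 zO] := decays_gtD lamy (rhoO 0) h1.
have := cvgD (decays_cvg0 lamy z0 zO) (cvg_cst eps).
move=> /(_ _ _); rewrite add0r; apply: cvg_trans; apply: near_eq_cvg.
by near=> t; rewrite fctE mul1r; ring.
Unshelve. all: by end_near. Qed.

Lemma time_scale_poly_decay lam phi eps eps2 (P : {poly R}) :
  time_scale lam phi eps eps2 -> decays_ge lam 0 (fun t => P.[phi t]).
Proof.
move=> ts; have lamy := ts_lam ts.
elim/poly_ind: P => [|P c IH].
  apply: (decays_ge_near _ (decays_geW lamy (decays0 lam 0))).
  by near=> t; rewrite horner0.
have h := decays_geM IH (time_scale_phi_decay ts).
rewrite addr0 in h.
apply: (decays_ge_near _ (decays_geD h (decays_geW lamy (decays_const lam c)))).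
by near=> t; rewrite hornerMXaddC.
Unshelve. all: by end_near. Qed.

Lemma time_scale_term_decay lam phi eps eps2 mu (P : {poly R}) :
  time_scale lam phi eps eps2 ->
  decays_ge lam mu (fun t => expR (- (mu * lam t)) * P.[phi t]).
Proof.
move=> ts; have lamy := ts_lam ts; rewrite -[mu in decays_ge _ mu]addr0.
apply: decays_geM; first exact: (decays_geW lamy (decays_exp _ _)).
exact: time_scale_poly_decay ts.
Qed.

Lemma time_scale_term_derive lam phi eps eps2 mu (P : {poly R}) :
  time_scale lam phi eps eps2 ->
  exists2 dg : R -> R,
    \forall t \near +oo,
      is_derive t (1 : R) (fun s => expR (- (mu * lam s)) * P.[phi s]) (dg t) &
    forall a, decays_gt lam a (fun t => dg t -
      (eps + eps2 * expR (- lam t)) *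
        (expR (- (mu * lam t)) * (P^`() - mu *: P).[phi t])).
Proof.
move=> ts; have lamy := ts_lam ts.
have [rho lrho rhoO] := ts_dlam ts; have [sig psig sigO] := ts_dphi ts.
exists (fun t => - (mu * rho t) * expR (- (mu * lam t)) * P.[phi t] +
  expR (- (mu * lam t)) * (P^`().[phi t] * sig t)).
  near=> t; apply: is_derive_mul.
    by apply: is_derive_expN; near: t.
  apply: (is_derive1_comp (f := horner P) (g := phi)).
    exact: is_derive_poly.
  by near: t.
move=> a.
have h1 := decays_gtM (sigO (a - mu)) (time_scale_term_decay (mu := mu) P^`() ts).
have h2 := decays_gtM (rhoO (a - mu)) (time_scale_term_decay (mu := mu) (mu *: P) ts).
rewrite !subrK in h1 h2.
apply: (decays_gt_near _ (decays_gtB lamy h1 h2)).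
by near=> t; rewrite hornerD hornerN hornerZ; ring.
Unshelve. all: by end_near. Qed.

Lemma ln_pinfty : (@ln R) t @[t --> +oo] --> +oo.
Proof.
apply/cvgryPge => A; near=> t.
have h : expR A <= t by near: t; apply: nbhs_pinfty_ge; exact: num_real.
have t0 : 0 < t := lt_le_trans (expR_gt0 A) h.
by rewrite -[A]expRK ler_ln ?posrE ?expR_gt0.
Unshelve. all: by end_near. Qed.

Lemma iterlog_pinfty m : (@iterlog R m) t @[t --> +oo] --> +oo.
Proof.
elim: m => [|m IH]; first exact: cvg_id.
exact: (cvg_comp _ _ IH ln_pinfty).
Qed.

Lemma iterlog_gt0 m : \forall t \near +oo, 0 < (iterlog m t : R).
Proof.
by apply: (iterlog_pinfty m (nbhs_pinfty_gt _)); exact: num_real.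
Qed.

Lemma iterlog_le m k : (m <= k)%N ->
  \forall t \near +oo, iterlog k t <= (iterlog m t : R).
Proof.
move=> /subnK <-; elim: (k - m)%N => [|j IH]; first by near=> t.
near=> t; rewrite addSn.
have h : 0 < iterlog (j + m) t by near: t; exact: iterlog_gt0.
rewrite {1}/iterlog iterS -/(iterlog _ _) (le_trans (ltW (ln_sublinear h))) //.
by near: t.
Unshelve. all: by end_near. Qed.

Lemma iterlog_derive m : exists2 rho : R -> R,
  \forall t \near +oo, is_derive t (1 : R) (iterlog m.+1) (rho t) &
  \forall t \near +oo, 0 <= rho t <= t^-1.
Proof.
elim: m => [|m [rho Hd Hle]].
  exists (fun t => t^-1); near=> t.
    have t0 : 0 < t by near: t; apply: nbhs_pinfty_gt; exact: num_real.
    exact: (is_derive1_ln t0).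
  have t0 : 0 < t by near: t; apply: nbhs_pinfty_gt; exact: num_real.
  by rewrite lexx invr_ge0 ltW.
exists (fun t => (iterlog m.+1 t)^-1 * rho t); near=> t.
  have h : 0 < iterlog m.+1 t by near: t; exact: iterlog_gt0.
  apply: (is_derive1_comp (f := @ln R) (g := iterlog m.+1)).
    exact: is_derive1_ln.
  by near: t.
have h : 1 <= iterlog m.+1 t by near: t; exact: (pinfty_near_ge (iterlog_pinfty m.+1)).
have /andP[r0 rt] : 0 <= rho t <= t^-1 by near: t.
rewrite mulr_ge0 ?invr_ge0 ?(le_trans ler01 h) //=.
apply: le_trans rt.
by rewrite ler_piMl // invf_le1 // (lt_le_trans ltr01).
Unshelve. all: by end_near. Qed.

(** For [m >= 2], [b * iterlog m t <= b * ln (ln t) <= ln t] eventually, whatever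
    [b]: the derivatives of the iterated logarithms, at most [t^-1], are
    negligible with respect to every power of [psi]. *)
Lemma inv_decays_iterlog m a : (2 <= m)%N -> decays (iterlog m) a (fun t : R => t^-1).
Proof.
move=> m2; apply: (@decays_weaken _ _ (iterlog_pinfty m) a (`|a| + 1)).
  by rewrite (le_trans (ler_norm a)) // lerDl.
set b := `|a| + 1; have b0 : 0 < b by rewrite ltr_wpDl.
exists 1; near=> t.
have t0 : 0 < t by near: t; apply: nbhs_pinfty_gt; exact: num_real.
have h1 : iterlog m t <= iterlog 2 t by near: t; exact: iterlog_le.
(* [ln x = ln (x / (2 b)) + ln (2 b) <= x / (2 b) + ln (2 b)], with
   [x = ln t]; the bound below makes the second term small enough. *)
have h2 : b * ln (b *+ 2) * 2 <= iterlog 1 t by near: t; exact: (pinfty_near_ge (iterlog_pinfty 1)).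
have h3 : 0 < iterlog 1 t by near: t; exact: iterlog_gt0.
rewrite mul1r ger0_norm ?invr_ge0 ?(ltW t0) //.
rewrite -[t^-1]lnK ?posrE ?invr_gt0 // ler_expR lnV ?posrE // lerN2.
apply: (@le_trans _ _ (b * iterlog 2 t)); first by rewrite ler_pM2l.
have b20 : 0 < b *+ 2 by rewrite mulrn_wgt0.
have -> : iterlog 2 t = ln (iterlog 1 t / (b *+ 2)) + ln (b *+ 2).
  by rewrite -lnM ?posrE ?divr_gt0 // divfK // gt_eqF.
rewrite -[X in _ <= X]/(iterlog 1 t) mulrDr.
have h4 : ln (iterlog 1 t / (b *+ 2)) < iterlog 1 t / (b *+ 2).
  by apply: ln_sublinear; rewrite divr_gt0.
have h5 : b * (iterlog 1 t / (b *+ 2)) = iterlog 1 t / 2.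
  by rewrite -mulr_natr; field; rewrite gt_eqF.
have h6 : b * ln (iterlog 1 t / (b *+ 2)) <= iterlog 1 t / 2.
  by rewrite -h5 ler_pM2l // ltW.
lra.
Unshelve. all: by end_near. Qed.

Definition log_psi (ty : pair_type) : R -> R :=
  match ty with
  | Type1 => id
  | Type2 => @ln R
  | Type3 ms _ _ => iterlog ms.+1
  end.

Definition inv_psi_coef (ty : pair_type) : R := if ty is Type2 then 1 else 0.

Lemma psi_powR ty a : \forall t \near +oo, psi ty t `^ (- a) = expR (- (a * log_psi ty t)).
Proof.
case: ty => [||ms ns H] /=; near=> t.
- by rewrite -expRM mulrN mulrC.
- have t0 : 0 < t by near: t; apply: nbhs_pinfty_gt; exact: num_real.
  by rewrite /powR gt_eqF // mulNr.
- have t0 : 0 < iterlog ms t by near: t; exact: iterlog_gt0.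
  by rewrite /powR gt_eqF // mulNr.
Unshelve. all: by end_near. Qed.

Lemma time_scale_pair ty : time_scale (log_psi ty) (phi ty) (epsilon R ty) (inv_psi_coef ty).
Proof.
case: ty => [||ms ns H]; rewrite /epsilon /=.
- split; [exact: cvg_id|exact: cvg_id|by near=> t| | |by right].
    exists (fun=> 1); first by near=> t; exact: is_derive_id.
    move=> a; apply: (decays_gt_near _ (decays_gt0 _ a)).
    by near=> t; rewrite mul0r addr0 subrr.
  exists (fun=> 1); first by near=> t; exact: is_derive_id.
  move=> a; apply: (decays_gt_near _ (decays_gt0 _ a)).
  by near=> t; rewrite mul0r addr0 subrr.
- have H : exists2 rho : R -> R,
      \forall t \near +oo, is_derive t (1 : R) (@ln R) (rho t) &
      forall a, decays_gt (@ln R) a (fun t => rho t - (0 + 1 * expR (- ln t))).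
    exists (fun t => t^-1); first last.
      move=> a; apply: (decays_gt_near _ (decays_gt0 _ a)).
      near=> t; have t0 : 0 < t by near: t; apply: nbhs_pinfty_gt; exact: num_real.
      by rewrite mul1r add0r expRN lnK ?posrE // subrr.
    near=> t; have t0 : 0 < t by near: t; apply: nbhs_pinfty_gt; exact: num_real.
    exact: (is_derive1_ln t0).
  by split=> //; [exact: ln_pinfty|exact: ln_pinfty|by near=> t|left].
- have /andP[ms1 nsm] := H.
  have D m : exists2 rho : R -> R,
      \forall t \near +oo, is_derive t (1 : R) (iterlog m.+1) (rho t) &
      forall a, decays_gt (iterlog ms.+1) a
        (fun t => rho t - (0 + 0 * expR (- iterlog ms.+1 t))).
    have [rho rhod rhole] := iterlog_derive m; exists rho => // a.
    exists (a + 1); first by rewrite ltrDl.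
    apply: decays_le (inv_decays_iterlog (a + 1) (ms1 : (1 < ms.+1)%N)).
    near=> t; rewrite mul0r addr0 subr0.
    have /andP[r0 rt] : 0 <= rho t <= t^-1 by near: t.
    by rewrite !ger0_norm // (le_trans r0).
  split; [exact: iterlog_pinfty|exact: iterlog_pinfty|exact: iterlog_le|exact: D| |by left].
  by rewrite /phi; case: ns nsm H => // ns _ _; exact: D.
Unshelve. all: by end_near. Qed.

End TimeScale.

(** * The linear equation for one coefficient *)

Section LinearStep.
Variable R : realType.
Implicit Types (P Q : {poly R}) (lam phi : R -> R).

(** Induction on the degree: if [Q1] is the solution for [P^`()], then
    [(P - e *: Q1) / c] is the solution for [P]. *)
Lemma poly_first_order_ode (c e : R) P : c != 0 ->
  exists Q, c *: Q + e *: Q^`() = P.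
Proof.
move=> c0; elim: (size P) {-2}P (leqnn (size P)) => [|n IH] {}P sP.
  exists 0; rewrite deriv0 !scaler0 addr0.
  by apply/esym/eqP; rewrite -size_poly_leq0.
have [|Q1 HQ1] := IH P^`().
  have [->|P0] := eqVneq P 0; first by rewrite linear0 size_poly0.
  by rewrite -ltnS (leq_trans (lt_size_deriv P0)).
exists (c^-1 *: (P - e *: Q1)).
rewrite derivZ derivB derivZ scalerA divff // scale1r -HQ1.
by rewrite addrK (scalerA c^-1) mulVf // scale1r subrK.
Qed.

Lemma poly_antiderivative P : exists Q, Q^`() = P.
Proof.
exists (\poly_(i < (size P).+1) (P`_i.-1 / i%:R)).
apply/polyP => i; rewrite coef_deriv coef_poly ltnS /=.
case: ltnP => [_|sP]; last by rewrite mul0rn nth_default.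
by rewrite -[LHS]mulr_natr divfK // pnatr_eq0.
Qed.

(** The heart of the induction. Subtracting the term of the polynomial solution
    [Q] leaves a function [u] with [u' = - d u + k], where [k] decays faster
    than the power [mu]. If [eps * mu < d], the damping is strong enough for [u]
    to inherit the decay of [k]. Otherwise [psi] is the exponential of [t], and
    [expR (d * t) * u t] has an exponentially small derivative, hence a limit
    [c]. If [d < mu], the assumed decay of [w] forces [c = 0]; if [d = mu], the
    equation for [Q] reads [Q^`() = P], and [c] is the free constant of its
    solution. *)
Lemma scalar_linear_step lam phi (eps eps2 d mu : R) (w h : R -> R) P :
  time_scale lam phi eps eps2 -> 0 < d ->
  (\forall t \near +oo, is_derive t (1 : R) w (- (d * w t) + h t)) ->
  decays_gt lam mu (fun t => h t - expR (- (mu * lam t)) * P.[phi t]) ->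
  (eps = 1 -> d < mu -> decays_gt lam d w) ->
  exists2 Q, d *: Q + eps *: (Q^`() - mu *: Q) = P &
    decays_gt lam mu (fun t => w t - expR (- (mu * lam t)) * Q.[phi t]).
Proof.
move=> ts d0 dw hP wd; have lamy := ts_lam ts.
have correct Q : d *: Q + eps *: (Q^`() - mu *: Q) = P ->
  exists2 k : R -> R, decays_gt lam mu k &
    \forall t \near +oo, is_derive t (1 : R)
      (fun s => w s - expR (- (mu * lam s)) * Q.[phi s])
      (- (d * (w t - expR (- (mu * lam t)) * Q.[phi t])) + k t).
  move=> HQ.
  have [dg dgd dgO] := time_scale_term_derive mu Q ts.
  exists (fun t => h t - dg t - d * (expR (- (mu * lam t)) * Q.[phi t])).
    have h1 : decays_gt lam mu (fun t => expR (- (1 * lam t)) *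
        (expR (- (mu * lam t)) * (Q^`() - mu *: Q).[phi t])).
      apply: (@decays_ge_gt _ _ _ (1 + mu)); first by rewrite ltrDr.
      apply: decays_geM; first exact: decays_geW (decays_exp _ _).
      exact: time_scale_term_decay ts.
    have := decays_gtB lamy (decays_gtB lamy hP (dgO mu))
      (decays_gtZ eps2 h1).
    apply: decays_gt_near; near=> t.
    have -> : P.[phi t] = d * Q.[phi t] + eps * (Q^`() - mu *: Q).[phi t].
      by rewrite -HQ !(hornerD, hornerZ).
    by rewrite mul1r; ring.
  near=> t.
  have -> : - (d * (w t - expR (- (mu * lam t)) * Q.[phi t])) +
     (h t - dg t - d * (expR (- (mu * lam t)) * Q.[phi t])) =
     (- (d * w t) + h t) - dg t by ring.
  apply: is_derive_sub; first by near: t.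
  by near: t.
have [emd|dem] := ltP (eps * mu) d.
  have [Q HQ] : exists Q, d *: Q + eps *: (Q^`() - mu *: Q) = P.
    have [|Q HQ] := @poly_first_order_ode (d - eps * mu) eps P.
      by rewrite subr_eq0 gt_eqF.
    exists Q; rewrite -HQ scalerBr scalerBl scalerA.
    by rewrite addrA addrAC.
  exists Q => //.
  have [k [nu munu kO] ud] := correct Q HQ.
  (* A rate for [u]: at most that of [k], and slower than the damping. *)
  have [xi [xinu muxi exid]] : exists xi, [/\ xi <= nu, mu < xi & eps * xi < d].
    case: (ts_eps ts) => [->|[e1 _ _]].
      by exists nu; rewrite mul0r.
    rewrite e1 mul1r in emd; exists (Num.min nu ((mu + d) / 2)).
    rewrite e1 mul1r; split; first by rewrite ge_min lexx.
      by rewrite lt_min munu /=; lra.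
    by rewrite gt_min; apply/orP; right; lra.
  exists xi => //.
  have [rho rhod rhol] := time_scale_rate ts.
  apply: (@linear_ode_decay _ lam rho d xi ((d - eps * xi) / 2) _ k).
  - by rewrite divr_gt0 // subr_gt0.
  - exact: rhod.
  - have : xi * rho t @[t --> +oo] --> xi * eps.
      by apply: cvgM => //; exact: cvg_cst.
    move=> /cvgr_le/(_ (d - (d - eps * xi) / 2)) H.
    have {}H : \forall t \near +oo, xi * rho t <= d - (d - eps * xi) / 2.
      by apply: H; lra.
    by near=> t; rewrite lerBrDl addrC -lerBrDl; near: t.
  - exact: ud.
  - exact: decays_weaken kO.
have [e1 e20 lamid] : [/\ eps = 1, eps2 = 0 & lam = id].
  case: (ts_eps ts) => // e0.
  by move: dem; rewrite e0 mul0r leNgt d0.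
rewrite e1 mul1r in dem; move: hP wd correct; rewrite e1 lamid => hP wd correct.
have conv Q : d *: Q + 1 *: (Q^`() - mu *: Q) = P ->
  exists2 c, decays_gt id mu
    (fun t => w t - expR (- (mu * t)) * Q.[phi t] - c * expR (- (d * t))) &
    d < mu -> c = 0.
  move=> HQ; have [k [nu munu kO] ud] := correct Q HQ.
  pose u t := w t - expR (- (mu * t)) * Q.[phi t].
  have expd : decays id (- d) (fun t => expR (d * t)).
    exists 1; near=> t.
    by rewrite mul1r ger0_norm ?expR_ge0 // mulNr opprK.
  have [c cO] : exists c,
      decays id (nu - d) (fun t => expR (d * t) * u t - c).
    apply: (@integrable_derivative_limit _ _ _ (fun t => expR (d * t) * k t)).
    - lra.
    - near=> t.
      have -> : expR (d * t) * k t = d * 1 * expR (d * t) * u t +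
        expR (d * t) * (- (d * u t) + k t) by ring.
      apply: is_derive_mul; last by near: t.
      exact: (is_derive_expMl d (is_derive_id _ _)).
    - by rewrite addrC; exact: decaysM expd kO.
  exists c.
    exists nu => //.
    have -> : nu = d + (nu - d) by ring.
    have := decaysM (decays_exp id d) cO.
    apply: decays_near; near=> t.
    by rewrite mulrBr mulrA -expRD addNr expR0 mul1r (mulrC c).
  move=> dmu; have idy := lamy; rewrite lamid in idy.
  have u_d : decays_gt id d u.
    apply: (decays_gtB idy); first exact: wd.
    apply: decays_ge_gt dmu _.
    have := time_scale_term_decay (mu := mu) Q ts; rewrite lamid; apply.
  have [xi dxi uO] := u_d.
  have g0 := decaysM expd uO.
  have g1 : expR (d * t) * u t @[t --> +oo] --> 0.
    by apply: (decays_cvg0 idy _ g0); rewrite addrC subr_gt0.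
  have g2 : expR (d * t) * u t - c @[t --> +oo] --> 0.
    by apply: (decays_cvg0 idy _ cO); rewrite subr_gt0 (le_lt_trans dem).
  have g3 : expR (d * t) * u t - (expR (d * t) * u t - c) @[t --> +oo]
      --> 0 - 0 by exact: cvgB.
  have E : (fun t => expR (d * t) * u t - (expR (d * t) * u t - c)) = cst c.
    by apply/funext => t; rewrite /cst /=; ring.
  rewrite E subr0 in g3.
  exact: (cvg_unique _ (cvg_cst c) g3).
have [dmu|mud] := ltP d mu.
  have [Q HQ] : exists Q, d *: Q + 1 *: (Q^`() - mu *: Q) = P.
    have [|Q HQ] := @poly_first_order_ode (d - mu) 1 P.
      by rewrite subr_eq0 lt_eqF.
    exists Q; rewrite -HQ scalerBr scalerBl !scale1r.
    by rewrite addrA addrAC.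
  exists Q => //; have [c + /(_ dmu) c0] := conv Q HQ.
  apply: decays_gt_near; near=> t.
  by rewrite c0 mul0r subr0.
have dmu : d = mu by apply/le_anti; rewrite dem.
have [Q0 HQ0] := poly_antiderivative P.
have HQ Q : Q^`() = P -> d *: Q + 1 *: (Q^`() - mu *: Q) = P.
  by move=> <-; rewrite scale1r dmu addrC subrK.
have [c + _] := conv Q0 (HQ _ HQ0).
move=> cO; exists (Q0 + c%:P).
  by apply: HQ; rewrite derivD derivC addr0.
apply: decays_gt_near cO; near=> t.
by rewrite hornerD hornerC dmu; ring.
Unshelve. all: by end_near. Qed.

End LinearStep.

(** * Multilinear mappings and resonant sums *)

Section MultilinearForms.
Variables (R : realType) (n : nat).
Local Notation V := 'cV[R]_n.

Definition ffcons (T : Type) m (x : T) (w : {ffun 'I_m -> T}) :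
    {ffun 'I_m.+1 -> T} :=
  [ffun i => if unlift ord0 i is Some j then w j else x].

Lemma ffcons0 T m (x : T) (w : {ffun 'I_m -> T}) : ffcons x w ord0 = x.
Proof. by rewrite ffunE unlift_none. Qed.

Lemma ffconsS T m (x : T) (w : {ffun 'I_m -> T}) i :
  ffcons x w (lift ord0 i) = w i.
Proof. by rewrite ffunE liftK. Qed.

Lemma multilinear_head m (M : {ffun 'I_m.+1 -> V} -> V) w a x y :
  multilinear M ->
  M (ffcons (a *: x + y) w) = a *: M (ffcons x w) + M (ffcons y w).
Proof.
move=> /(_ (ffcons 0 w) ord0 a x y) /=.
suff E z : [ffun j => if j == ord0 then z else ffcons 0 w j] = ffcons z w.
  by rewrite !E.
apply/ffunP => j; rewrite !ffunE; case: unliftP => [i ->|-> //].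
by rewrite -[_ == _]negbK eq_sym neq_lift.
Qed.

Lemma multilinear_tail m (M : {ffun 'I_m.+1 -> V} -> V) u :
  multilinear M -> multilinear (fun w => M (ffcons u w)).
Proof.
move=> Mlin v i a x y /=.
have := Mlin (ffcons u v) (lift ord0 i) a x y => /=.
suff E z : [ffun j => if j == lift ord0 i then z else ffcons u v j] =
    ffcons u [ffun j => if j == i then z else v j] by rewrite !E.
apply/ffunP => j; rewrite !ffunE; case: unliftP => [k ->|->].
  by rewrite (inj_eq (@lift_inj _ ord0)) ffunE.
by rewrite (negPf (neq_lift _ _)).
Qed.

(** Coordinates reduce multilinear algebra to products of scalars, and the
    expansion over sums to the distributivity of products over sums. The
    monomials are kept in a list, rather than indexed by all families of
    coordinates, so that the induction on the number of arguments needs no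
    reindexing. *)
Lemma multilinear_form m (M : {ffun 'I_m -> V} -> V) : multilinear M ->
  exists T : seq (V * {ffun 'I_m -> 'I_n}),
    forall v, M v = \sum_(c <- T) (\prod_i v i (c.2 i) 0) *: c.1.
Proof.
elim: m M => [|m IH] M Mlin.
  have i0 : {ffun 'I_0 -> 'I_n} := ffun0 (card_ord 0).
  exists [:: (M [ffun=> 0], i0)] => v.
  rewrite big_seq1 big_ord0 scale1r; congr M.
  by apply/ffunP => -[].
have /choice[T HT] a := IH _ (@multilinear_tail _ _ (delta_mx a 0) Mlin).
exists [seq (c.1, ffcons a c.2) | a <- enum 'I_n, c <- T a] => v.
rewrite big_allpairs_dep /=.
pose w := [ffun i => v (lift ord0 i)].
have -> : v = ffcons (v ord0) w.
  apply/ffunP => j; rewrite !ffunE; case: unliftP => [k ->|-> //].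
  by rewrite ffunE.
have head x : M (ffcons x w) = \sum_a x a 0 *: M (ffcons (delta_mx a 0) w).
  have M0 : M (ffcons 0 w) = 0.
    have := multilinear_head w (-1) 0 0 Mlin.
    by rewrite scaleN1r oppr0 addr0 scaleN1r addNr.
  have -> : x = \sum_a x a 0 *: delta_mx a 0.
    rewrite {1}[x]matrix_sum_delta; apply: eq_bigr => a _.
    by rewrite big_ord1.
  transitivity (\sum_a x a 0 *: M (ffcons (delta_mx a 0) w)); last first.
    apply: eq_bigr => a _; congr (_ *: _).
    rewrite summxE (bigD1 a) //= big1 => [|b ba]; rewrite !mxE !eqxx ?mulr1 ?addr0 //.
    by rewrite eq_sym (negPf ba) mulr0.
  elim: index_enum => [|a r IHr]; first by rewrite !big_nil.
  by rewrite !big_cons multilinear_head // IHr.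
rewrite head big_enum /=; apply: eq_bigr => a _.
rewrite HT scaler_sumr; apply: eq_bigr => c _.
rewrite scalerA big_ord_recl ffcons0 !ffcons0; congr (_ * _ *: _).
by apply: eq_bigr => i _; rewrite !ffconsS.
Qed.

Lemma multilinear_sum m (M : {ffun 'I_m -> V} -> V) (J : finType)
    (F : 'I_m -> J -> V) : multilinear M ->
  M [ffun i => \sum_j F i j] =
  \sum_(f : {ffun 'I_m -> J}) M [ffun i => F i (f i)].
Proof.
move=> /multilinear_form[T HT]; rewrite HT.
under [RHS]eq_bigr do rewrite HT.
rewrite exchange_big /=; apply: eq_bigr => c _.
rewrite -scaler_suml; congr (_ *: _).
under eq_bigr do rewrite ffunE summxE.
rewrite bigA_distr_bigA; apply: eq_bigr => f _.
by apply: eq_bigr => i _; rewrite ffunE.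
Qed.

Lemma multilinear_scale m (M : {ffun 'I_m -> V} -> V) (c : 'I_m -> R)
    (x : 'I_m -> V) : multilinear M ->
  M [ffun i => c i *: x i] = (\prod_i c i) *: M [ffun i => x i].
Proof.
move=> /multilinear_form[T HT]; rewrite !HT scaler_sumr.
apply: eq_bigr => e _; rewrite scalerA; congr (_ *: _).
rewrite -big_split /=; apply: eq_bigr => i _.
by rewrite !ffunE mxE.
Qed.

Lemma multilinear_vpoly m (M : {ffun 'I_m -> V} -> V) (q : 'I_m -> vpoly R n) :
  multilinear M ->
  exists r : vpoly R n, forall z, veval r z = M [ffun i => veval (q i) z].
Proof.
move=> /multilinear_form[T HT].
exists (\col_r \sum_(c <- T) (\prod_i q i (c.2 i) 0) * (c.1 r 0)%:P) => z.
rewrite HT; apply/matrixP => r k; rewrite !mxE summxE horner_sum.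
apply: eq_bigr => c _; rewrite hornerM hornerC ord1 mxE horner_prod.
by congr (_ * _); apply: eq_bigr => i _; rewrite ffunE mxE.
Qed.

End MultilinearForms.

Lemma another_index m (i : 'I_m) : (2 <= m)%N -> exists i', i' != i.
Proof.
move=> m2; have m0 : (0 < m)%N by exact: ltn_trans m2.
have [->|i0] := eqVneq i (Ordinal m0); first by exists (Ordinal m2).
by exists (Ordinal m0); rewrite eq_sym.
Qed.

Section ResonantSums.
Variables (R : realType) (n : nat) (mu : nat -> R).
Hypotheses (mu_gt0 : forall k, 0 < mu k) (mu_incr : increasing_seq mu).
Variable Gml : forall m : nat, {ffun 'I_m -> 'cV[R]_n} -> 'cV[R]_n.

Lemma mu_le i j : (mu i <= mu j) = (i <= j)%N.
Proof. exact: mu_incr. Qed.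

Lemma mu_lt i j : (mu i < mu j) = (i < j)%N.
Proof. by rewrite !ltNge mu_incr -ltnNge. Qed.

Lemma mu_inj : injective mu.
Proof.
by move=> i j ij; apply/eqP; rewrite eqn_leq -!mu_le ij lexx.
Qed.

Lemma mu_sum_ge m (j : 'I_m -> nat) : m%:R * mu 0%N <= \sum_i mu (j i).
Proof.
have -> : m%:R * mu 0%N = \sum_(i < m) mu 0%N.
  by rewrite sumr_const card_ord mulr_natl.
by apply: ler_sum => i _; rewrite mu_le.
Qed.

Lemma mu_sum_gt m (j : 'I_m -> nat) i : (2 <= m)%N ->
  mu (j i) + mu 0%N <= \sum_i mu (j i).
Proof.
move=> m2.
have [i' i'i] := another_index i m2.
rewrite (bigD1 i) //= (bigD1 i') //= lerD2l -[mu 0%N]addr0 lerD //.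
by apply: sumr_ge0 => l _; exact: ltW.
Qed.

(** As [m >= 2] and the exponents are positive, [\sum_i mu (j i) = mu k] forces
    each [j i < k], and [m * mu 0 <= mu k] bounds [m]. The bounds [N] and [M] are
    left free: [N = k] shows that only the coefficients before the [k]th
    occur, while larger common bounds allow sums over several [k]. *)
Lemma resonant_sum_finite (q : nat -> vpoly R n) k z N M : (k <= N)%N ->
  mu k < M.+1%:R * mu 0%N ->
  resonant_sum mu Gml q k z =
  \sum_(2 <= m < M.+1)
    \sum_(j : {ffun 'I_m -> 'I_N} | \sum_i mu (j i) == mu k)
      Gml [ffun i => veval (q (j i)) z].
Proof.
move=> kN kM; rewrite /resonant_sum (fsbigE (index_iota 2 M.+1)).
- rewrite big_nat_cond [RHS]big_nat_cond; apply: eq_big => m.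
    rewrite andbT; apply/andP/idP => [[]//|mM]; split=> //.
    by apply/mem_set; case/andP: mM.
  move=> /andP[/andP[m2 _] _].
  pose h (j : {ffun 'I_m -> 'I_N}) : {ffun 'I_m -> nat} := [ffun i => val (j i)].
  rewrite (reindex_fsbig h
    [set` [pred j : {ffun 'I_m -> 'I_N} | \sum_i mu (j i) == mu k]]); last first.
    split.
    - move=> j /= /eqP <-; apply: eq_bigr => i _; by rewrite ffunE.
    - move=> j1 j2 _ _ /ffunP h12; apply/ffunP => i; apply: val_inj.
      by have := h12 i; rewrite !ffunE.
    - move=> j /= jk.
      have jN i : (j i < N)%N.
        apply: leq_trans kN; rewrite -mu_lt -jk.
        apply: lt_le_trans (mu_sum_gt _ i m2).
        by rewrite ltrDl.
      exists [ffun i => Ordinal (jN i)]; last by apply/ffunP => i; rewrite !ffunE.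
      by rewrite /= -jk; apply/eqP/eq_bigr => i _; rewrite ffunE.
  rewrite -(bigfs _ (index_enum_uniq _)) /=; last first.
    by move=> j _; rewrite mem_index_enum.
  apply: eq_bigr => j _; congr Gml; apply/ffunP => i; by rewrite !ffunE.
- exact: iota_uniq.
- by move=> m /=; rewrite mem_index_iota => /andP[].
- move=> m /= m2; rewrite mem_index_iota m2 /= -leqNgt => Mm.
  rewrite fsbig1 // => j /= jk.
  have := mu_sum_ge j; rewrite jk leNgt (lt_le_trans kM) //.
  by rewrite ler_pM2r // ler_nat.
Qed.

End ResonantSums.

(** * Vector valued functions *)

Section Vectors.
Variables (R : realType) (n : nat).
Implicit Types (v : 'cV[R]_n) (g : R -> 'cV[R]_n).

(** Unlike the Euclidean norm, this one is additive in the entries, which suits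
    estimates by components. *)
Definition vnorm1 v : R := \sum_i `|v i 0|.

Lemma vnorm1_ge0 v : 0 <= vnorm1 v.
Proof. by apply: sumr_ge0. Qed.

Lemma entry_le_vnorm1 v i : `|v i 0| <= vnorm1 v.
Proof. by rewrite /vnorm1 (bigD1 i) //= lerDl sumr_ge0. Qed.

Lemma entry_le_enorm v i : `|v i 0| <= enorm v.
Proof.
rewrite /enorm -sqrtr_sqr ler_wsqrtr // (bigD1 i) //= lerDl.
by apply: sumr_ge0 => j _; rewrite sqr_ge0.
Qed.

Lemma enorm_ge0 v : 0 <= enorm v.
Proof. exact: sqrtr_ge0. Qed.

Lemma enorm_le_vnorm1 v : enorm v <= vnorm1 v.
Proof.
rewrite -[vnorm1 v]ger0_norm ?vnorm1_ge0 // -sqrtr_sqr ler_wsqrtr //.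
rewrite expr2 [X in _ <= X * _]/vnorm1 mulr_suml; apply: ler_sum => i _.
by rewrite -real_normK ?num_real // expr2 ler_wpM2l // entry_le_vnorm1.
Qed.

Lemma mulmx_entry_le m (B : 'M[R]_(m, n)) : exists2 K, 0 < K &
  forall v i, `|(B *m v) i 0| <= K * vnorm1 v.
Proof.
exists (1 + \sum_i \sum_j `|B i j|).
  by rewrite ltr_pwDl // sumr_ge0 // => i _; rewrite sumr_ge0.
move=> v i; rewrite mxE (le_trans (ler_norm_sum _ _ _)) //.
rewrite /vnorm1 mulr_sumr; apply: ler_sum => j _.
rewrite normrM ler_wpM2r //.
rewrite (bigD1 i) //= (bigD1 j) //=.
have h1 : 0 <= \sum_(i0 < n | i0 != j) `|B i i0| by rewrite sumr_ge0.
have h2 : 0 <= \sum_(i0 < m | i0 != i) \sum_j `|B i0 j|.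
  by rewrite sumr_ge0 // => k _; rewrite sumr_ge0.
have h3 : (0 : R) <= 1 by []; lra.
Qed.

Definition vdecays_gt (l : R -> R) a g :=
  forall i, decays_gt l a (fun t => g t i 0).

Definition vdecays_ge (l : R -> R) a g :=
  forall i, decays_ge l a (fun t => g t i 0).

Definition vterm (l ph : R -> R) (mu : R) (p : vpoly R n) (t : R) : 'cV[R]_n :=
  expR (- (mu * l t)) *: veval p (ph t).

Section VDecay.
Variables (l : R -> R).
Hypothesis ly : l t @[t --> +oo] --> +oo.

Lemma vdecays_gt_near a g h : (\forall t \near +oo, g t = h t) ->
  vdecays_gt l a g -> vdecays_gt l a h.
Proof.
move=> gh gO i; apply: decays_gt_near (gO i); near=> t.
by have -> : g t = h t by near: t.
Unshelve. all: by end_near. Qed.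

Lemma vdecays_gtD a g h : vdecays_gt l a g -> vdecays_gt l a h ->
  vdecays_gt l a (fun t => g t + h t).
Proof.
move=> gO hO i; apply: decays_gt_near (decays_gtD ly (gO i) (hO i)).
by near=> t; rewrite mxE.
Unshelve. all: by end_near. Qed.

Lemma vdecays_gtN a g : vdecays_gt l a g -> vdecays_gt l a (fun t => - g t).
Proof.
move=> gO i; apply: decays_gt_near (decays_gtN (gO i)).
by near=> t; rewrite mxE.
Unshelve. all: by end_near. Qed.

Lemma vdecays_gtB a g h : vdecays_gt l a g -> vdecays_gt l a h ->
  vdecays_gt l a (fun t => g t - h t).
Proof. by move=> gO /vdecays_gtN; exact: vdecays_gtD. Qed.

Lemma vdecays_gt_sum a (I : Type) (r : seq I) (P : pred I)
    (F : I -> R -> 'cV[R]_n) : (forall i, P i -> vdecays_gt l a (F i)) ->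
  vdecays_gt l a (fun t => \sum_(i <- r | P i) F i t).
Proof.
move=> FO j; have := decays_gt_sum ly r (fun i Pi => FO i Pi j).
by apply: decays_gt_near; near=> t; rewrite summxE.
Unshelve. all: by end_near. Qed.

Lemma vdecays_gt_mulmx a (B : 'M[R]_n) g : vdecays_gt l a g ->
  vdecays_gt l a (fun t => B *m g t).
Proof.
move=> gO i.
have := @decays_gt_sum _ _ ly a _ (index_enum 'I_n) xpredT
  (fun j t => B i j * g t j 0) (fun j _ => decays_gtZ (B i j) (gO j)).
by apply: decays_gt_near; near=> t; rewrite mxE.
Unshelve. all: by end_near. Qed.

Lemma vdecays_gt0 a : vdecays_gt l a (fun=> 0).
Proof.
move=> i; apply: decays_gt_near (decays_gt0 l a).
by near=> t; rewrite mxE.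
Unshelve. all: by end_near. Qed.

Lemma vdecays_ge_gt a b g : a < b -> vdecays_ge l b g -> vdecays_gt l a g.
Proof. by move=> ab gO i; exact: decays_ge_gt (gO i). Qed.

Lemma vdecays_gt_weaken a b g : a <= b -> vdecays_gt l b g -> vdecays_gt l a g.
Proof. by move=> ab gO i; exact: decays_gt_weaken (gO i). Qed.

End VDecay.

Lemma vterm_decay l ph e e2 mu (p : vpoly R n) : time_scale l ph e e2 ->
  vdecays_ge l mu (vterm l ph mu p).
Proof.
move=> ts i; apply: decays_ge_near (time_scale_term_decay (p i 0) ts).
by near=> t; rewrite !mxE.
Unshelve. all: by end_near. Qed.

(** All estimates are made entry by entry; the finitely many entries of a
    remainder have a common rate. *)
Lemma asymp_expansionP ty g (p : nat -> vpoly R n) (mu : nat -> R) :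
  asymp_expansion g p mu (phi ty) (psi ty) <->
  forall N : nat, vdecays_gt (@log_psi R ty) (mu N)
    (fun t => g t - \sum_(k < N.+1) vterm (@log_psi R ty) (phi ty) (mu k) (p k) t).
Proof.
have ts := time_scale_pair R ty; have ly := ts_lam ts.
have E N : \forall t \near +oo,
    g t - \sum_(k < N.+1) psi ty t `^ (- mu k) *: veval (p k) (phi ty t) =
    g t - \sum_(k < N.+1) vterm (@log_psi R ty) (phi ty) (mu k) (p k) t.
  have H : \forall t \near +oo, forall k : 'I_N.+1,
      psi ty t `^ (- mu k) = expR (- (mu k * log_psi ty t)).
    by apply: filter_forall => k; exact: psi_powR.
  near=> t.
  have Hk : forall k : 'I_N.+1,
      psi ty t `^ (- mu k) = expR (- (mu k * log_psi ty t)) by near: t.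
  by congr (_ - _); apply: eq_bigr => k _; rewrite Hk.
split=> H N.
  have [nu munu [T [C [T0 C0 HT]]]] := H N.
  move=> i; exists nu => //; exists C; near=> t.
  have Et : g t - \sum_(k < N.+1) psi ty t `^ (- mu k) *: veval (p k) (phi ty t) =
    g t - \sum_(k < N.+1) vterm (@log_psi R ty) (phi ty) (mu k) (p k) t by near: t.
  have Pt : psi ty t `^ (- nu) = expR (- (nu * log_psi ty t)).
    by near: t; exact: psi_powR.
  have Tt : T <= t by near: t; apply: nbhs_pinfty_ge; exact: num_real.
  by rewrite -Et -Pt (le_trans (entry_le_enorm _ _)) // HT.
pose h t := g t - \sum_(k < N.+1) vterm (@log_psi R ty) (phi ty) (mu k) (p k) t.
have [nu munu [C HC]] : decays_gt (@log_psi R ty) (mu N) (fun t => vnorm1 (h t)).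
  apply: (@decays_gt_sum _ _ ly _ _ _ _ (fun i t => `|h t i 0|)) => i _.
  have [nu munu hO] := H N i; exists nu => //.
  by apply: decays_le hO; near=> t; rewrite normr_id.
exists nu => //.
have /near_pinftyP[T HT] : \forall t \near +oo,
  enorm (g t - \sum_(k < N.+1) psi ty t `^ (- mu k) *: veval (p k) (phi ty t))
    <= (`|C| + 1) * psi ty t `^ (- nu).
  near=> t.
  have -> : g t - \sum_(k < N.+1) psi ty t `^ (- mu k) *: veval (p k) (phi ty t) =
    h t by near: t; exact: E.
  have -> : psi ty t `^ (- nu) = expR (- (nu * log_psi ty t)).
    by near: t; exact: psi_powR.
  rewrite (le_trans (enorm_le_vnorm1 _)) //.
  rewrite -[vnorm1 _]ger0_norm ?vnorm1_ge0 //.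
  apply: (@le_trans _ _ (C * expR (- (nu * log_psi ty t)))); first by near: t.
  by rewrite ler_wpM2r ?expR_ge0 // (le_trans (ler_norm C)) // lerDl.
exists (Num.max T 1), (`|C| + 1); split.
- by rewrite lt_max ltr01 orbT.
- by rewrite ltr_wpDl.
- by move=> t; rewrite ge_max => /andP[Tt _]; exact: HT.
Unshelve. all: by end_near. Qed.

End Vectors.

(** * The nonlinearity near the origin *)

Section Nonlinearity.
Variables (R : realType) (n : nat).
Variables (G : 'cV[R]_n -> 'cV[R]_n) (Gm : nat -> 'cV[R]_n -> 'cV[R]_n).
Variable Gml : forall m : nat, {ffun 'I_m -> 'cV[R]_n} -> 'cV[R]_n.
Hypothesis G_lip : locally_lipschitz G.
Hypothesis G_exp : power_expansion_at0 G Gm.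
Hypothesis Gml_multilinear : forall m, (2 <= m)%N -> multilinear (@Gml m).
Hypothesis Gml_diag :
  forall m, (2 <= m)%N -> forall y, Gm m y = Gml [ffun i : 'I_m => y].

Lemma Gm_scale m s y : (2 <= m)%N -> Gm m (s *: y) = s ^+ m *: Gm m y.
Proof.
move=> m2; rewrite !Gml_diag //.
have := multilinear_scale (fun=> s) (fun=> y) (Gml_multilinear m2).
by rewrite prodr_const card_ord.
Qed.

Lemma Gm_at_0 m : (2 <= m)%N -> Gm m 0 = 0.
Proof.
move=> m2; rewrite -(scale0r (0 : 'cV[R]_n)) Gm_scale // expr0n.
by case: m m2 => // m _; rewrite !scale0r.
Qed.

(** The expansion of [G] holds in a punctured neighborhood only, so the value at
    the origin comes from the continuity of [G], along the points
    [s *: const_mx 1] with [s > 0] tending to zero. *)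
Lemma G_at_0 : G 0 = 0.
Proof.
have [U U0 /near_pinftyP[K HK]] := G_lip 0.
have {}HK x y : U x -> U y -> `|G x - G y| <= `|K| * `|x - y|.
  by move=> Ux Uy; exact: (HK `|K| (ler_norm K) (x, y)).
have [delta d0 [C C0 HC]] := G_exp (leqnn 2).
have {}HC : nbhs (0 : 'cV[R]_n) [set y | y != 0 ->
    enorm (G y - \sum_(2 <= m < 3) Gm m y) <= C * enorm y `^ (2%:R + delta)].
  exact: HC.
pose e : 'cV[R]_n := const_mx 1.
have se0 : s *: e @[s --> 0^'+] --> (0 : 'cV[R]_n).
  rewrite -(scale0r e); apply: cvgZr_tmp.
  exact/cvg_at_right_filter/cvg_id.
have evn : vnorm1 e = n%:R.
  rewrite /vnorm1 (eq_bigr (fun=> 1)) ?sumr_const ?card_ord // => i _.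
  by rewrite mxE normr1.
apply/matrixP => i j; rewrite ord1 mxE; apply/eqP; rewrite -normr_le0 leNgt.
apply/negP => Gi.
pose B := `|K| * `|e| + C * n%:R `^ (2%:R + delta) + `|Gm 2 e i 0|.
have B0 : 0 <= B.
  by rewrite !addr_ge0 ?mulr_ge0 ?powR_ge0 // ltW.
suff H : \forall s \near (0 : R)^'+, `|G 0 i 0| <= s * B.
  have : \forall s \near (0 : R)^'+, False.
    near=> s.
    have s0 : 0 < s by near: s; exact: nbhs_right_gt.
    have sl : s < `|G 0 i 0| / (B + 1).
      by near: s; apply: nbhs_right_lt; rewrite divr_gt0 // ltr_wpDl.
    have : `|G 0 i 0| <= s * B by near: s.
    rewrite leNgt => /negP; apply.
    rewrite ltr_pdivlMr ?ltr_wpDl // in sl.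
    by apply: le_lt_trans sl; rewrite ler_pM2l // lerDl.
  by move=> /filter_ex[].
near=> s.
have s0 : 0 < s by near: s; exact: nbhs_right_gt.
have s1 : s < 1 by near: s; exact: nbhs_right_lt.
have Us : U (s *: e) by near: s; exact: (se0 _ U0).
have Hs : s *: e != 0 -> enorm (G (s *: e) - \sum_(2 <= m < 3) Gm m (s *: e))
   <= C * enorm (s *: e) `^ (2%:R + delta) by near: s; exact: (se0 _ HC).
have {}Hs := Hs _.
have se : s *: e != 0.
  apply/eqP => /matrixP/(_ i 0); rewrite !mxE mulr1 => s00.
  by rewrite s00 ltxx in s0.
have {}Hs := Hs se; rewrite big_nat1 in Hs.
have h1 : `|(G 0 - G (s *: e)) i 0| <= `|K| * (s * `|e|).
  apply: (@le_trans _ _ `|G 0 - G (s *: e)|).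
    rewrite [leRHS]/Num.Def.normr/= mx_normrE.
    exact: (le_bigmax _ (fun ij : 'I_n * 'I_1 => `|(G 0 - G (s *: e)) ij.1 ij.2|) (i, 0)).
  apply: le_trans (HK _ _ (nbhs_singleton U0) Us) _.
  by rewrite sub0r normrN normrZ (gtr0_norm s0).
have h2 : `|(G (s *: e) - Gm 2 (s *: e)) i 0| <= s * (C * n%:R `^ (2%:R + delta)).
  apply: (le_trans (entry_le_enorm _ _)); apply: (le_trans Hs).
  rewrite mulrCA ler_pM2l //.
  have d20 : 0 <= 2%:R + delta by rewrite addr_ge0 // ltW.
  apply: (@le_trans _ _ ((s * n%:R) `^ (2%:R + delta))).
    apply: ge0_ler_powR => //; rewrite ?nnegrE ?enorm_ge0 ?mulr_ge0 // ?(ltW s0) //.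
    apply: (le_trans (enorm_le_vnorm1 _)); rewrite -evn /vnorm1 mulr_sumr.
    by apply: ler_sum => k _; rewrite mxE normrM (gtr0_norm s0).
  rewrite powRM ?(ltW s0) // ler_wpM2r ?powR_ge0 //.
  apply: ge1r_powR; first by rewrite s0 ltW.
  by move: d0; lra.
have h3 : `|Gm 2 (s *: e) i 0| <= s * `|Gm 2 e i 0|.
  rewrite Gm_scale // mxE normrM ler_wpM2r // ger0_norm ?sqr_ge0 //.
  by rewrite expr2 ler_piMl // ltW.
have -> : G 0 i 0 = (G 0 - G (s *: e)) i 0 + (G (s *: e) - Gm 2 (s *: e)) i 0 +
    Gm 2 (s *: e) i 0.
  by rewrite !mxE; ring.
rewrite /B !mulrDr (le_trans (ler_normD _ _)) // lerD // (le_trans (ler_normD _ _)) //.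
by rewrite lerD // mulrCA.
Unshelve. all: by end_near. Qed.

Lemma G_expansion_near N : (2 <= N)%N -> exists2 delta : R, 0 < delta &
  exists2 C : R, 0 < C & \forall y \near (0 : 'cV[R]_n),
    enorm (G y - \sum_(2 <= m < N.+1) Gm m y) <= C * enorm y `^ (N%:R + delta).
Proof.
move=> N2; have [delta d0 [C C0 HC]] := G_exp N2.
exists delta => //; exists C => //.
have {}HC : \forall y \near (0 : 'cV[R]_n), y != 0 ->
    enorm (G y - \sum_(2 <= m < N.+1) Gm m y) <= C * enorm y `^ (N%:R + delta).
  exact: HC.
near=> y; have [->|y0] := eqVneq y 0; last by move: y0; near: y.
rewrite G_at_0 big_nat big1 => [|m /andP[m2 _]]; last exact: Gm_at_0.
rewrite subr0 /enorm big1 ?sqrtr0 ?mulr_ge0 ?powR_ge0 ?(ltW C0) // => i _.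
by rewrite mxE expr0n.
Unshelve. all: by end_near. Qed.

Variable y : R -> 'cV[R]_n.
Hypothesis y_lim : y t @[t --> +oo] --> (0 : 'cV[R]_n).

Lemma entry_cvg0 i : y t i 0 @[t --> +oo] --> 0.
Proof.
have H : {for (0 : 'cV[R]_n), continuous (fun M : 'cV[R]_n => M i 0)}.
  exact: coord_continuous.
have := cvg_comp _ _ y_lim H; rewrite mxE; exact.
Qed.

Lemma vnorm1_cvg0 : vnorm1 (y t) @[t --> +oo] --> 0.
Proof.
rewrite /vnorm1; elim: index_enum => [|i r IH].
  have -> : (fun t => \sum_(i <- [::]) `|y t i 0|) = cst (0 : R).
    by apply/funext => t; rewrite big_nil.
  exact: cvg_cst.
have -> : (fun t => \sum_(j <- i :: r) `|y t j 0|) =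
    (fun t => `|y t i 0| + \sum_(j <- r) `|y t j 0|).
  by apply/funext => t; rewrite big_cons.
rewrite -[X in _ --> X]addr0; apply: cvgD IH.
by apply/norm_cvg0P; exact: entry_cvg0.
Qed.

Lemma G_quadratic : exists2 K, 0 < K & \forall t \near +oo, forall i,
  `|G (y t) i 0| <= K * vnorm1 (y t) ^+ 2.
Proof.
have [delta d0 [C C0 HC]] := G_expansion_near (leqnn 2).
have [T HT] := multilinear_form (Gml_multilinear (leqnn 2)).
exists (C + \sum_(c <- T) vnorm1 c.1).
  by rewrite ltr_wpDr // sumr_ge0 // => c _; exact: vnorm1_ge0.
near=> t => i.
have s1 : vnorm1 (y t) <= 1.
  by near: t; apply: (cvgr_le _ vnorm1_cvg0).
have s0 := vnorm1_ge0 (y t).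
have Hy : enorm (G (y t) - \sum_(2 <= m < 3) Gm m (y t))
    <= C * enorm (y t) `^ (2%:R + delta) by near: t; exact: (y_lim HC).
rewrite big_nat1 in Hy.
have -> : G (y t) i 0 = (G (y t) - Gm 2 (y t)) i 0 + Gm 2 (y t) i 0.
  by rewrite !mxE subrK.
rewrite mulrDl (le_trans (ler_normD _ _)) // lerD //.
  apply: (le_trans (entry_le_enorm _ _)); apply: (le_trans Hy).
  rewrite ler_pM2l //.
  apply: (@le_trans _ _ (vnorm1 (y t) `^ (2%:R + delta))).
    apply: ge0_ler_powR; rewrite ?nnegrE ?enorm_ge0 ?vnorm1_ge0 //.
      by rewrite addr_ge0 // ltW.
    exact: enorm_le_vnorm1.
  have [->|sn0] := eqVneq (vnorm1 (y t)) 0.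
    by rewrite powR0 ?expr0n // gt_eqF // ltr_wpDl.
  rewrite -powR_mulrn //; apply: ger_powR; last by rewrite lerDl ltW.
  by rewrite s1 andbT lt_neqAle eq_sym sn0.
rewrite Gml_diag // HT summxE mulr_suml (le_trans (ler_norm_sum _ _ _)) //.
apply: ler_sum => c _; rewrite mxE normrM mulrC ler_pM ?entry_le_vnorm1 //.
rewrite big_ord_recl big_ord1 normrM !ffunE expr2.
by rewrite ler_pM // entry_le_vnorm1.
Unshelve. all: by end_near. Qed.

(** The extra [delta] in the exponent more than compensates the loss of rate in
    [decays_ge]: at the rate [nu] below, still less than [mu0], the bound has
    the rate [mu0 * (N + delta / 2)]. *)
Lemma G_remainder_decay (l : R -> R) mu0 N :
  l t @[t --> +oo] --> +oo -> 0 < mu0 -> (2 <= N)%N -> vdecays_ge l mu0 y ->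
  vdecays_gt l (N%:R * mu0)
    (fun t => G (y t) - \sum_(2 <= m < N.+1) Gm m (y t)).
Proof.
move=> ly mu00 N2 yO i.
have [delta d0 [C C0 HC]] := G_expansion_near N2.
have ND : 0 < N%:R + delta by rewrite ltr_wpDl.
pose nu := mu0 * (N%:R + delta / 2) / (N%:R + delta).
have numu : nu < mu0.
  rewrite /nu ltr_pdivrMr // ltr_pM2l // ltrD2l; lra.
have nuE : nu * (N%:R + delta) = mu0 * (N%:R + delta / 2).
  by rewrite /nu divfK // gt_eqF.
have sO : decays_ge l mu0 (fun t => vnorm1 (y t)).
  apply: (@decays_ge_sum _ _ ly mu0 _ _ _ (fun j t => `|y t j 0|)) => j _ xi.
  move=> /(yO j); apply: decays_le; near=> t.
  by rewrite normr_id.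
have [K HK] := sO _ numu.
exists (mu0 * (N%:R + delta / 2)).
  by rewrite mulrC ltr_pM2l // ltrDl divr_gt0.
exists (C * `|K| `^ (N%:R + delta)); near=> t.
apply: (le_trans (entry_le_enorm _ _)).
apply: (@le_trans _ _ (C * enorm (y t) `^ (N%:R + delta))).
  by near: t; exact: (y_lim HC).
rewrite -mulrA ler_pM2l // -nuE.
have -> : expR (- (nu * (N%:R + delta) * l t)) =
    expR (- (nu * l t)) `^ (N%:R + delta).
  by rewrite -expRM; congr expR; ring.
rewrite -powRM ?expR_ge0 //.
apply: ge0_ler_powR; rewrite ?nnegrE ?enorm_ge0 ?mulr_ge0 ?expR_ge0 ?(ltW ND) //.
apply: (le_trans (enorm_le_vnorm1 _)).
rewrite -[vnorm1 _]ger0_norm ?vnorm1_ge0 //.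
apply: (@le_trans _ _ (K * expR (- (nu * l t)))); first by near: t.
by rewrite ler_wpM2r ?expR_ge0 // ler_norm.
Unshelve. all: by end_near. Qed.

End Nonlinearity.

(** * The first decay estimate *)

Lemma energy_step (R : realType) (d0 dm0 kap k1 zz V a b FF : R) :
  2 * dm0 * zz <= 2 * d0 * zz -> b <= kap / 2 * zz + FF -> a <= k1 * zz + V ->
  - (2 * d0 * zz) + a + b <=
    (- (2 * dm0) + kap / 2 + k1) * zz + V + FF.
Proof. by lra. Qed.

Lemma energy_total (R : realType) (x dm0 m kap1 V dV X : R) :
  0 <= V -> kap1 * x * 2 <= (dm0 - m) / 2 ->
  dV <= (- (2 * dm0) + (dm0 - m) / 2 + kap1 * x) * V + x * (kap1 * V) + X ->
  dV + (dm0 + m) * V <= X.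
Proof.
move=> V0 kx; have : (kap1 * x * 2 - (dm0 - m) / 2) * V <= 0.
  by rewrite mulr_le0_ge0 // subr_le0.
by lra.
Qed.

Section InitialDecay.
Variables (R : realType) (n : nat).

Lemma vdecays_ge_mulmx (l : R -> R) a (B : 'M[R]_n) (g : R -> 'cV[R]_n) :
  l t @[t --> +oo] --> +oo ->
  vdecays_ge l a g -> vdecays_ge l a (fun t => B *m g t).
Proof.
move=> ly gO i.
have H j : decays_ge l a (fun t => B i j * g t j 0).
  by rewrite -[a]add0r; apply: decays_geM (gO j); exact: decays_geW (decays_const _ _).
have := decays_ge_sum ly (index_enum 'I_n) (P := xpredT) (fun j _ => H j).
by apply: decays_ge_near; near=> t; rewrite mxE.
Unshelve. all: by end_near. Qed.

Lemma vnorm1_le (v : 'cV[R]_n) B :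
  (forall i, `|v i 0| <= B) -> vnorm1 v <= n%:R * B.
Proof.
move=> H; apply: (@le_trans _ _ (\sum_(i < n) B)); first exact: ler_sum.
by rewrite sumr_const card_ord mulr_natl.
Qed.

Lemma is_derive_entry (y : R -> 'cV[R]_n) t i : derivable y t 1 ->
  is_derive t (1 : R) (fun s => y s i 0) (derive1 y t i 0).
Proof.
move=> dy; apply: DeriveDef; first exact: (derivable_mxP _ _ _).1.
by rewrite derive1E derive_mx // mxE.
Qed.

Lemma is_derive_mulmx (B : 'M[R]_n) (v : R -> 'cV[R]_n) (dv : 'cV[R]_n) t i :
  (forall j, is_derive t (1 : R) (fun s => v s j 0) (dv j 0)) ->
  is_derive t (1 : R) (fun s => (B *m v s) i 0) ((B *m dv) i 0).
Proof.
move=> H; have := @is_derive_lsum R _ (index_enum 'I_n) xpredT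
  (fun j s => B i j * v s j 0) (fun j => B i j * dv j 0) t
  (fun j => is_derive_scale (B i j) (H j)).
rewrite [in X in _ -> X]mxE; congr is_derive.
by apply/funext => s; rewrite mxE.
Qed.

Lemma mulmx_diagonalized (S A : 'M[R]_n) (d : 'rV[R]_n) (v h : 'cV[R]_n) i :
  S \in unitmx -> A = invmx S *m diag_mx d *m S ->
  (S *m (- (A *m v) + h)) i 0 = - (d 0 i * (S *m v) i 0) + (S *m h) i 0.
Proof.
move=> Su ->; rewrite mulmxDr mulmxN !mulmxA mulmxV // mul1mx -mulmxA.
by rewrite mul_diag_mx !mxE.
Qed.

Variables (l ph : R -> R) (e e2 mu0 dm : R).
Hypotheses (ts : time_scale l ph e e2) (mu0_gt0 : 0 < mu0).
Variables (S A : 'M[R]_n) (d : 'rV[R]_n).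
Hypotheses (Su : S \in unitmx) (AE : A = invmx S *m diag_mx d *m S).
Hypotheses (dm_gt0 : 0 < dm) (dm_le : forall i, dm <= d 0 i).
Hypothesis dm_mu0 : e * mu0 <= dm.
Variables (y g f : R -> 'cV[R]_n).
Hypothesis y_der : \forall t \near +oo, forall i, is_derive t (1 : R)
  (fun s => y s i 0) ((- (A *m y t) + (g t + f t)) i 0).
Hypothesis y_lim : vnorm1 (y t) @[t --> +oo] --> 0.
Hypothesis g_quad : exists2 K, 0 < K & \forall t \near +oo, forall i,
  `|g t i 0| <= K * vnorm1 (y t) ^+ 2.
Hypothesis f_decay : vdecays_ge l mu0 f.

Let z t := S *m y t.

(** The nonlinearity is quadratic in [y], which tends to zero. *)
Lemma nonlinearity_small kap : 0 < kap -> \forall t \near +oo, forall i,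
  `|(S *m g t) i 0| <= kap * vnorm1 (z t).
Proof.
move=> kap0; have [K K0 HK] := g_quad.
have [KS KS0 HKS] := mulmx_entry_le S.
have [KI KI0 HKI] := mulmx_entry_le (invmx S).
pose c := KS * (n%:R * K) * (n%:R * KI).
have c0 : 0 <= c by rewrite !mulr_ge0 // ltW.
near=> t => i.
have s0 := vnorm1_ge0 (y t).
have z0 := vnorm1_ge0 (z t).
have sk : vnorm1 (y t) <= kap / (c + 1).
  near: t; apply: (cvgr_le _ y_lim).
  by rewrite divr_gt0 // ltr_wpDl.
have hg : forall i, `|g t i 0| <= K * vnorm1 (y t) ^+ 2 by near: t.
have yz : vnorm1 (y t) <= n%:R * KI * vnorm1 (z t).
  rewrite -mulrA; apply: vnorm1_le => j.
  have -> : y t = invmx S *m z t by rewrite /z mulKmx.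
  exact: HKI.
apply: (le_trans (HKS _ _)).
apply: (@le_trans _ _ (KS * (n%:R * (K * vnorm1 (y t) ^+ 2)))).
  by rewrite ler_pM2l //; exact: vnorm1_le.
apply: (@le_trans _ _ (KS * (n%:R * (K * (vnorm1 (y t) * (n%:R * KI * vnorm1 (z t))))))).
  rewrite ler_pM2l // ler_wpM2l // ler_pM2l // expr2.
  by rewrite ler_wpM2l.
have -> : KS * (n%:R * (K * (vnorm1 (y t) * (n%:R * KI * vnorm1 (z t))))) =
  (c * vnorm1 (y t)) * vnorm1 (z t) by rewrite /c; ring.
rewrite ler_wpM2r //; apply: (@le_trans _ _ ((c + 1) * vnorm1 (y t))).
  by rewrite ler_wpM2r // lerDl.
by rewrite mulrC -ler_pdivlMr // ltr_wpDl.
Unshelve. all: by end_near. Qed.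

(** Energy estimate for [V = \sum_i z i ^ 2] in the coordinates [z] which
    diagonalize [A]. The linear part gives [V' <= - 2 dm V]; the nonlinearity
    and the forcing, each at the cost of [kap / 2 * V] with [kap = dm - nu e],
    leave [V' + (dm + nu e) V <= C psi ^ (- 2 nu)]. Since [dm + nu e > 2 nu e],
    a barrier of the size of the right-hand side applies. *)
Lemma initial_decay : vdecays_ge l mu0 y.
Proof.
have ly := ts_lam ts.
suff zO : vdecays_ge l mu0 z.
  have yz : y = fun t => invmx S *m z t.
    by apply/funext => t; rewrite /z mulKmx.
  by rewrite yz; exact: vdecays_ge_mulmx.
suff H nu : nu < mu0 -> exists2 K, 0 <= K & \forall t \near +oo,
    \sum_i (z t i 0) ^+ 2 <= K * expR (- (nu * 2 * l t)).
  move=> i nu /H[K K0 HK]; exists (K + 1); near=> t.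
  have hK : \sum_i (z t i 0) ^+ 2 <= K * expR (- (nu * 2 * l t)) by near: t.
  have E0 := expR_ge0 (- (nu * l t)).
  rewrite -ler_sqr ?nnegrE ?mulr_ge0 ?addr_ge0 // real_normK ?num_real //.
  apply: (@le_trans _ _ (\sum_i (z t i 0) ^+ 2)).
    by rewrite (bigD1 i) //= lerDl sumr_ge0 // => j _; rewrite sqr_ge0.
  apply: (le_trans hK); rewrite exprMn.
  have -> : expR (- (nu * 2 * l t)) = expR (- (nu * l t)) ^+ 2.
    by rewrite -expRM_natr; congr expR; ring.
  rewrite ler_wpM2r ?sqr_ge0 //.
  have := sqr_ge0 K; rewrite sqrrD expr1n mulr1; move: K0; lra.
move=> numu.
have nued : nu * e < dm.
  case: (ts_eps ts) => [->|[e1 _ _]]; first by rewrite mulr0.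
  by rewrite e1 mulr1; apply: lt_le_trans numu _; move: dm_mu0; rewrite e1 mul1r.
pose kap := dm - nu * e; have kap0 : 0 < kap by rewrite subr_gt0.
pose D := dm + nu * e.
have n0 : 0 < (n.*2.*2%:R : R) + 1 by rewrite ltr_wpDl.
(* [2 * n * kap1 <= kap / 2], since the sums over pairs of entries in the estimate
   of the nonlinearity amount to [2 * n * kap1 * V]. *)
pose kap1 := kap / ((n.*2.*2%:R : R) + 1).
have kap10 : 0 < kap1 by rewrite divr_gt0.
pose F t := S *m f t.
have FO : vdecays_ge l mu0 F by exact: vdecays_ge_mulmx.
have [CF HCF] : decays l (nu * 2) (fun t => \sum_i F t i 0 ^+ 2).
  apply: (@decays_ge_sum _ _ ly (mu0 + mu0) _ _ _ (fun i t => F t i 0 ^+ 2)).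
    move=> i _; apply: decays_ge_near (decays_geM (FO i) (FO i)).
    by near=> t; rewrite expr2.
  by move: numu; lra.
have [rho rhod rhol] := time_scale_rate ts.
pose dz t i := - (d 0 i * z t i 0) + (S *m (g t + f t)) i 0.
have zd : \forall t \near +oo, forall i,
    is_derive t (1 : R) (fun s => z s i 0) (dz t i).
  near=> t => i; rewrite /dz /z -(@mulmx_diagonalized _ A) //.
  by apply: is_derive_mulmx; near: t.
pose V t := \sum_i z t i 0 ^+ 2.
pose dV t := \sum_i (dz t i * z t i 0 + z t i 0 * dz t i).
have key : \forall t \near +oo,
    dV t + D * V t <= 2 / kap * \sum_i F t i 0 ^+ 2.
  near=> t.
  have gs : forall i, `|(S *m g t) i 0| <= kap1 * vnorm1 (z t).
    by near: t; exact: nonlinearity_small.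
  have step i : dz t i * z t i 0 + z t i 0 * dz t i <=
      (- (2 * dm) + kap / 2 + kap1 * n%:R) * z t i 0 ^+ 2 + kap1 * V t +
      2 / kap * F t i 0 ^+ 2.
    have h1 : dz t i * z t i 0 + z t i 0 * dz t i =
       - (2 * d 0 i * z t i 0 ^+ 2) + 2 * (z t i 0 * (S *m g t) i 0) +
       2 * (z t i 0 * F t i 0).
      by rewrite /dz mulmxDr !mxE /F; ring.
    have h2 : 2 * dm * z t i 0 ^+ 2 <= 2 * d 0 i * z t i 0 ^+ 2.
      by rewrite ler_wpM2r ?sqr_ge0 // ler_pM2l.
    have h3 : 2 * (z t i 0 * F t i 0) <=
        kap / 2 * z t i 0 ^+ 2 + 2 / kap * F t i 0 ^+ 2.
      rewrite -subr_ge0.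
      have -> : kap / 2 * z t i 0 ^+ 2 + 2 / kap * F t i 0 ^+ 2 -
        2 * (z t i 0 * F t i 0) = kap / 2 * (z t i 0 - 2 / kap * F t i 0) ^+ 2.
        by field; rewrite gt_eqF.
      by rewrite mulr_ge0 ?sqr_ge0 // divr_ge0 // ltW.
    have h4 : 2 * (z t i 0 * (S *m g t) i 0) <=
        kap1 * n%:R * z t i 0 ^+ 2 + kap1 * V t.
      apply: (@le_trans _ _ (2 * (`|z t i 0| * (kap1 * vnorm1 (z t))))).
        rewrite ler_pM2l // (le_trans (ler_norm _)) // normrM.
        by rewrite ler_wpM2l.
      have -> : kap1 * n%:R * z t i 0 ^+ 2 + kap1 * V t =
        \sum_j kap1 * (z t i 0 ^+ 2 + z t j 0 ^+ 2).
        rewrite -mulr_sumr big_split /= sumr_const card_ord.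
        by rewrite -(mulr_natl (z t i 0 ^+ 2) n) mulrDr mulrA.
      have -> : 2 * (`|z t i 0| * (kap1 * vnorm1 (z t))) =
          \sum_j kap1 * (2 * (`|z t i 0| * `|z t j 0|)).
        by rewrite -mulr_sumr -mulr_sumr -mulr_sumr /vnorm1; ring.
      apply: ler_sum => j _; rewrite ler_pM2l //.
      rewrite -subr_ge0 -(real_normK (num_real (z t i 0))).
      rewrite -(real_normK (num_real (z t j 0))).
      have -> : `|z t i 0| ^+ 2 + `|z t j 0| ^+ 2 - 2 * (`|z t i 0| * `|z t j 0|)
        = (`|z t i 0| - `|z t j 0|) ^+ 2 by ring.
      exact: sqr_ge0.
    rewrite h1; exact: energy_step h2 h3 h4.
  have V0 : 0 <= V t by apply: sumr_ge0 => i _; exact: sqr_ge0.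
  have : dV t <= (- (2 * dm) + kap / 2 + kap1 * n%:R) * V t +
      n%:R * (kap1 * V t) + 2 / kap * \sum_i F t i 0 ^+ 2.
    apply: (le_trans (ler_sum _ (fun i _ => step i))).
    rewrite !big_split /= -!mulr_sumr sumr_const card_ord.
    by rewrite -(mulr_natl (V t) n) (mulrCA kap1).
  move=> H; apply: (energy_total V0 _ H).
  rewrite /kap1 -(ler_pM2r n0).
  have -> : kap / (n.*2.*2%:R + 1) * n%:R * 2 * (n.*2.*2%:R + 1) = kap * (n%:R * 2).
    by field; rewrite gt_eqF.
  rewrite -mulrA ler_pM2l // -!muln2 !natrM.
  by lra.
apply: (@barrier R D (kap / 2) (2 / kap * `|CF|) V dV
    (fun t => expR (- (nu * 2 * l t)))
    (fun t => - (nu * 2 * rho t) * expR (- (nu * 2 * l t)))).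
- by rewrite divr_gt0.
- by rewrite mulr_ge0 // divr_ge0 // ltW.
have rhon : \forall t \near +oo, nu * 2 * rho t <= D - kap / 2.
  have : nu * 2 * rho t @[t --> +oo] --> nu * 2 * e.
    by apply: cvgM => //; exact: cvg_cst.
  move=> /cvgr_le; apply; rewrite /D /kap; move: kap0; rewrite /kap; lra.
near=> t; split.
- have zdt : forall i, is_derive t (1 : R) (fun s => z s i 0) (dz t i).
    by near: t.
  rewrite /dV; have -> : V = fun s => \sum_i z s i 0 * z s i 0.
    by apply/funext => s; apply: eq_bigr => i _; rewrite expr2.
  apply: is_derive_lsum => i; exact: is_derive_mul.
- by apply: is_derive_expN; near: t.
- exact: expR_gt0.
- rewrite -mulrDl ler_wpM2r ?expR_ge0 //.
  have : nu * 2 * rho t <= D - kap / 2 by near: t.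
  by lra.
- have h1 : dV t + D * V t <= 2 / kap * \sum_i F t i 0 ^+ 2 by near: t.
  apply: (le_trans h1); rewrite -[leRHS]mulrA ler_wpM2l ?divr_ge0 ?(ltW kap0) //.
  apply: (le_trans (ler_norm _)).
  apply: (@le_trans _ _ (CF * expR (- (nu * 2 * l t)))); first by near: t.
  by rewrite ler_wpM2r ?expR_ge0 // ler_norm.
Unshelve. all: by end_near. Qed.

End InitialDecay.

(** * The expansion of the nonlinearity along a solution *)

Section NonlinearExpansion.
Variables (R : realType) (n : nat).
Variables (G : 'cV[R]_n -> 'cV[R]_n) (Gm : nat -> 'cV[R]_n -> 'cV[R]_n).
Variable Gml : forall m : nat, {ffun 'I_m -> 'cV[R]_n} -> 'cV[R]_n.
Hypothesis G_lip : locally_lipschitz G.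
Hypothesis G_exp : power_expansion_at0 G Gm.
Hypothesis Gml_multilinear : forall m, (2 <= m)%N -> multilinear (@Gml m).
Hypothesis Gml_diag :
  forall m, (2 <= m)%N -> forall y, Gm m y = Gml [ffun i : 'I_m => y].
Variable mu : nat -> R.
Hypotheses (mu_gt0 : forall k, 0 < mu k) (mu_incr : increasing_seq mu).
Hypothesis mu_add : forall x y : R, range mu x -> range mu y -> range mu (x + y).
Variables (l ph : R -> R) (e e2 : R).
Hypothesis ts : time_scale l ph e e2.

(** [mu k + mu 0] is an exponent greater than [mu k]. *)
Lemma mu_succ_le k : mu k.+1 <= mu k + mu 0%N.
Proof.
have [j _ jE] : range mu (mu k + mu 0%N).
  by apply: mu_add; [exists k|exists 0%N].
rewrite -jE mu_le //; suff : mu k < mu j by rewrite mu_lt.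
by rewrite jE ltrDl.
Qed.

Lemma mu_sum_range m (j : 'I_m.+1 -> nat) : range mu (\sum_i mu (j i)).
Proof.
elim: m j => [|m IH] j; first by rewrite big_ord1; exists (j ord0).
by rewrite big_ord_recl; apply: mu_add; [exists (j ord0)|exact: IH].
Qed.

(** What is known of the remainder [v] once [N] terms have been subtracted. The
    point is that, in both cases, multiplying [v] by a function of class
    [decays_ge (mu 0)] yields one of class [decays_gt (mu N)]: products that
    contain the unknown remainder do not disturb the [N]th equation. *)
Definition remainder_class (N : nat) (v : R -> 'cV[R]_n) :=
  if N is N'.+1 then vdecays_gt l (mu N') v else vdecays_ge l (mu 0%N) v.

Lemma remainder_class_ge N v : remainder_class N v -> vdecays_ge l (mu 0%N) v.
Proof.
case: N => //= N vO i; apply: decays_ge_weaken (decays_gt_ge (ts_lam ts) (vO i)).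
by rewrite mu_le.
Qed.

Lemma remainder_class_mul N v w i : remainder_class N v ->
  decays_ge l (mu 0%N) w -> decays_gt l (mu N) (fun t => v t i 0 * w t).
Proof.
case: N => [|N] /= vO wO.
  apply: (@decays_ge_gt _ _ _ (mu 0%N + mu 0%N)); first by rewrite ltrDl.
  exact: decays_geM.
apply: decays_gt_weaken (decays_gtM (vO i) wO).
exact: mu_succ_le.
Qed.

Variable q : nat -> vpoly R n.
Variable N : nat.
Variable y : R -> 'cV[R]_n.
Let v t := y t - \sum_(k < N) vterm l ph (mu k) (q k) t.
Hypothesis vO : remainder_class N v.

(* The terms found so far, and last the remainder: [y] is their sum. *)
Let F (k : nat) t := if (k < N)%N then vterm l ph (mu k) (q k) t else v t.

Lemma expansion_terms t : y t = \sum_(k < N.+1) F k t.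
Proof.
rewrite big_ord_recr /= /F ltnn (eq_bigr (fun k : 'I_N => vterm l ph (mu k) (q k) t)).
  by rewrite addrC subrK.
by move=> k _; rewrite ltn_ord.
Qed.

Lemma expansion_term_decay k : vdecays_ge l (mu 0%N) (F k).
Proof.
rewrite /F => i; case: ltnP => _; last exact: (remainder_class_ge vO).
by apply: decays_ge_weaken (vterm_decay (q k) ts i); rewrite mu_le.
Qed.

Lemma expansion_decay : vdecays_ge l (mu 0%N) y.
Proof.
move=> i.
have := decays_ge_sum (ts_lam ts) (index_enum 'I_N.+1) (P := xpredT)
  (fun k _ => expansion_term_decay k i).
apply: decays_ge_near; near=> t.
by rewrite expansion_terms summxE.
Unshelve. all: by end_near. Qed.

(** One factor is the remainder and, as [m >= 2], there is another one. *)
Lemma multilinear_remainder_decay m (j : {ffun 'I_m -> 'I_N.+1}) i0 :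
  (2 <= m)%N -> j i0 = N :> nat ->
  vdecays_gt l (mu N) (fun t => Gml [ffun i => F (j i) t]).
Proof.
move=> m2 ji0; have ly := ts_lam ts.
have [T HT] := multilinear_form (Gml_multilinear m2).
have [i1 i1i0] := another_index i0 m2.
move=> r.
have prodO (c : 'cV[R]_n * {ffun 'I_m -> 'I_n}) :
    decays_gt l (mu N) (fun t => c.1 r 0 * \prod_i F (j i) t (c.2 i) 0).
  apply: decays_gtZ.
  have restO : decays_ge l (mu 0%N)
      (fun t => F (j i1) t (c.2 i1) 0 *
        \prod_(i | (i != i0) && (i != i1)) F (j i) t (c.2 i) 0).
    rewrite -[mu 0%N]addr0; apply: decays_geM; first exact: expansion_term_decay.
    have := @decays_ge_prod _ _ ly 0 _ (index_enum 'I_m)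
      (fun i => (i != i0) && (i != i1)) (fun i t => F (j i) t (c.2 i) 0).
    rewrite big1 //; apply=> i _.
    by apply: decays_ge_weaken (expansion_term_decay _ _); exact: ltW.
  apply: decays_gt_near (remainder_class_mul (c.2 i0) vO restO).
  near=> t; rewrite [RHS](bigD1 i0) //= [in RHS](bigD1 i1) //=.
  by congr (_ * _); rewrite /F ji0 ltnn.
have := decays_gt_sum ly T (P := xpredT) (fun c _ => prodO c).
apply: decays_gt_near; near=> t.
rewrite HT summxE; apply: eq_bigr => c _.
by rewrite mxE mulrC; congr (_ * _); apply: eq_bigr => i _; rewrite ffunE.
Unshelve. all: by end_near. Qed.

(** If no factor is the remainder, the product of the terms has the exponent
    [\sum_i mu (j i)], which is some [mu k0]. For [k0 <= N] the difference
    vanishes; for [k0 > N] the subtracted sum is empty and the product is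
    negligible. If some factor is the remainder, [\sum_i mu (j i) > mu N] and the
    subtracted sum is empty as well. *)
Lemma multilinear_term_expansion m (j : {ffun 'I_m -> 'I_N.+1}) :
  (2 <= m)%N -> vdecays_gt l (mu N) (fun t => Gml [ffun i => F (j i) t] -
    \sum_(k < N.+1 | \sum_i mu (j i) == mu k)
      expR (- (mu k * l t)) *: Gml [ffun i => veval (q (j i)) (ph t)]).
Proof.
move=> m2; have ly := ts_lam ts.
have [/forallP jN|] := boolP [forall i, (j i < N)%N]; last first.
  rewrite negb_forall => /existsP[i0]; rewrite -leqNgt => Nj.
  have ji0 : j i0 = N :> nat.
    by apply/eqP; rewrite eqn_leq Nj -ltnS ltn_ord.
  apply: vdecays_gt_near (multilinear_remainder_decay m2 ji0).
  near=> t; rewrite big_pred0 ?subr0 // => k.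
  have := mu_sum_gt mu_gt0 mu_incr (fun i => j i : nat) i0 m2; rewrite ji0 => H.
  apply/negP => /eqP Hk; move: H; rewrite Hk leNgt.
  have : mu k <= mu N by rewrite mu_le // -ltnS.
  by move=> /le_lt_trans -> //; rewrite ltrDl.
have [r Hr] := multilinear_vpoly (fun i => q (j i)) (Gml_multilinear m2).
have E t : Gml [ffun i => F (j i) t] =
    expR (- ((\sum_i mu (j i)) * l t)) *: veval r (ph t).
  rewrite Hr mulr_suml -sumrN expR_sum.
  rewrite -(multilinear_scale _ _ (Gml_multilinear m2)); congr Gml.
  by apply/ffunP => i; rewrite !ffunE /F jN.
have [k0 _ k0E] : range mu (\sum_i mu (j i)).
  by case: m m2 j jN r Hr E => // m _ j *; exact: mu_sum_range.
have [k0N|Nk0] := ltnP k0 N.+1.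
  apply: vdecays_gt_near (vdecays_gt0 l _); near=> t.
  rewrite (big_pred1 (Ordinal k0N)) /=; last first.
    move=> k; rewrite -k0E /=; apply/eqP/eqP => [/(mu_inj mu_incr) k0k|-> //].
    exact: val_inj.
  by rewrite E Hr -k0E subrr.
have := vdecays_ge_gt _ (vterm_decay (mu := mu k0) r ts).
move=> /(_ (mu N)); rewrite mu_lt // => /(_ Nk0).
apply: vdecays_gt_near; near=> t.
rewrite big_pred0 ?subr0; last first.
  move=> k; rewrite -k0E; apply/eqP => /(mu_inj mu_incr) k0k.
  by move: Nk0; rewrite k0k ltnNge -ltnS ltn_ord.
by rewrite E -k0E.
Unshelve. all: by end_near. Qed.

(** Replace [G] by its Taylor polynomial of degree [M], expand each homogeneous
    part over the terms of [y], and collect the products by exponent. *)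
Lemma nonlinear_expansion : vnorm1 (y t) @[t --> +oo] --> 0 ->
  vdecays_gt l (mu N) (fun t => G (y t) -
    \sum_(k < N.+1) expR (- (mu k * l t)) *: resonant_sum mu Gml q k (ph t)).
Proof.
move=> y_lim1; have ly := ts_lam ts.
have y_lim : y t @[t --> +oo] --> (0 : 'cV[R]_n).
  apply/norm_cvg0P.
  apply: (@squeeze_cvgr _ _ _ _ (fun=> 0) (fun t => vnorm1 (y t))) => //.
    near=> t; rewrite normr_ge0 /= [leLHS]/Num.Def.normr/= mx_normrE.
    apply: bigmax_le; first exact: vnorm1_ge0.
    by move=> [i j] _; rewrite ord1; exact: entry_le_vnorm1.
  exact: cvg_cst.
have [M M2 HM] : exists2 M, (2 <= M)%N & mu N < M%:R * mu 0%N.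
  exists (Num.bound (mu N / mu 0%N)).+2 => //.
  rewrite -ltr_pdivrMr //.
  apply: (@lt_trans _ _ (Num.bound (mu N / mu 0%N))%:R); last first.
    by rewrite ltr_nat.
  by apply: archi_boundP; rewrite divr_ge0 // ltW.
have remO : vdecays_gt l (mu N) (fun t => G (y t) - \sum_(2 <= m < M.+1) Gm m (y t)).
  apply: (vdecays_gt_weaken (ltW HM)).
  have yO := expansion_decay.
  by apply: (@G_remainder_decay _ _ G Gm Gml).
have mainO : vdecays_gt l (mu N) (fun t =>
    \sum_(2 <= m < M.+1 | (2 <= m < M.+1)%N && true)
      \sum_(j : {ffun 'I_m -> 'I_N.+1}) (Gml [ffun i => F (j i) t] -
        \sum_(k < N.+1 | \sum_i mu (j i) == mu k)
          expR (- (mu k * l t)) *: Gml [ffun i => veval (q (j i)) (ph t)])).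
  apply: vdecays_gt_sum => // m /andP[/andP[m2 _] _].
  by apply: vdecays_gt_sum => // j _; exact: multilinear_term_expansion.
apply: vdecays_gt_near (vdecays_gtD ly remO mainO); near=> t.
rewrite -big_nat_cond.
have -> : \sum_(2 <= m < M.+1) Gm m (y t) = \sum_(2 <= m < M.+1)
    \sum_(j : {ffun 'I_m -> 'I_N.+1}) Gml [ffun i => F (j i) t].
  rewrite big_nat [RHS]big_nat; apply: eq_bigr => m /andP[m2 _].
  rewrite Gml_diag // -(multilinear_sum (fun i k => F (k : 'I_N.+1) t)) //.
    by congr Gml; apply/ffunP => i; rewrite !ffunE -expansion_terms.
  exact: Gml_multilinear.
under eq_bigr do rewrite sumrB.
rewrite sumrB addrA subrK; congr (_ - _).
transitivity (\sum_(2 <= m < M.+1) \sum_(k < N.+1)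
    expR (- (mu k * l t)) *: \sum_(j : {ffun 'I_m -> 'I_N.+1} |
      \sum_i mu (j i) == mu k) Gml [ffun i => veval (q (j i)) (ph t)]).
  apply: eq_bigr => m _; rewrite (exchange_big_dep xpredT) //=.
  by apply: eq_bigr => k _; rewrite scaler_sumr.
rewrite exchange_big /=; apply: eq_bigr => k _.
rewrite (@resonant_sum_finite _ _ _ mu_gt0 mu_incr _ _ _ _ N.+1 M) ?scaler_sumr //.
  exact: ltnW.
apply: (@le_lt_trans _ _ (mu N)); first by rewrite mu_le // -ltnS.
by apply: (lt_trans HM); rewrite ltr_pM2r // ltr_nat.
Unshelve. all: by end_near. Qed.

End NonlinearExpansion.

(** * Polynomial coefficients *)

Section VectorPolynomials.
Variables (R : realType) (n : nat).
Implicit Types (p q : vpoly R n).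

Lemma vevalD p q z : veval (p + q) z = veval p z + veval q z.
Proof. by apply/matrixP => i j; rewrite !mxE hornerD. Qed.

Lemma vevalB p q z : veval (p - q) z = veval p z - veval q z.
Proof. by apply/matrixP => i j; rewrite !mxE hornerD hornerN. Qed.

Lemma veval0 z : veval (0 : vpoly R n) z = 0.
Proof. by apply/matrixP => i j; rewrite !mxE horner0. Qed.

Lemma vevalZ c p z : veval (c%:P *: p) z = c *: veval p z.
Proof. by apply/matrixP => i j; rewrite !mxE hornerM hornerC. Qed.

Definition cmulmx (B : 'M[R]_n) p : vpoly R n := map_mx polyC B *m p.

Lemma veval_cmulmx B p z : veval (cmulmx B p) z = B *m veval p z.
Proof.
apply/matrixP => i j; rewrite !mxE horner_sum; apply: eq_bigr => k _.
by rewrite !mxE hornerM hornerC.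
Qed.

Lemma vderiv_cmulmx B p : vderiv (cmulmx B p) = cmulmx B (vderiv p).
Proof.
apply/matrixP => i j; rewrite !mxE raddf_sum; apply: eq_bigr => k _.
by rewrite !mxE /= derivM derivC mul0r add0r.
Qed.

Lemma vpoly_sum (I : Type) (r : seq I) (P : pred I) (F : I -> R -> 'cV[R]_n) :
  (forall i, P i -> exists s : vpoly R n, forall z, veval s z = F i z) ->
  exists s : vpoly R n, forall z, veval s z = \sum_(i <- r | P i) F i z.
Proof.
move=> HF; elim: r => [|i r [s Hs]].
  by exists 0 => z; rewrite veval0 big_nil.
case Pi: (P i); last by exists s => z; rewrite big_cons Pi.
have [s' Hs'] := HF i Pi.
by exists (s' + s) => z; rewrite big_cons Pi vevalD Hs' Hs.
Qed.

(** If [P * 'X + c] tends to zero along [ph], then so does [P], because [ph]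
    tends to infinity; hence induction on the degree. *)
Lemma poly_vanishing (ph : R -> R) (P : {poly R}) :
  ph t @[t --> +oo] --> +oo -> P.[ph t] @[t --> +oo] --> 0 -> P = 0.
Proof.
move=> phy; elim/poly_ind: P => [//|P c IH] H.
have ph_gt0 : \forall t \near +oo, 0 < ph t.
  near=> t; apply: (lt_le_trans ltr01); near: t; exact: pinfty_near_ge.
have phV : (ph t)^-1 @[t --> +oo] --> 0.
  exact/gtr0_cvgV0.
have P0 : P = 0.
  apply: IH.
  have H1 : ((P * 'X + c%:P).[ph t] - c) * (ph t)^-1 @[t --> +oo] --> (0 - c) * 0.
    by apply: cvgM => //; apply: cvgB => //; exact: cvg_cst.
  rewrite mulr0 in H1; apply: cvg_trans H1; apply: near_eq_cvg.
  near=> t; have ph0 : ph t != 0.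
    by rewrite gt_eqF //; near: t.
  by rewrite hornerMXaddC addrK mulfK.
move: H; rewrite P0 mul0r add0r => H.
have Hc : (c%:P).[ph t] @[t --> +oo] --> c.
  have -> : (fun t => (c%:P).[ph t]) = cst c by apply/funext => t; rewrite hornerC.
  exact: cvg_cst.
by rewrite (cvg_unique _ Hc H).
Unshelve. all: by end_near. Qed.

Lemma vterm_derive (l ph : R -> R) (e e2 mu : R) p : time_scale l ph e e2 ->
  exists2 dg : R -> 'cV[R]_n,
    \forall t \near +oo, forall i,
      is_derive t (1 : R) (fun s => vterm l ph mu p s i 0) (dg t i 0) &
    forall a, vdecays_gt l a (fun t => dg t -
      (e + e2 * expR (- l t)) *: vterm l ph mu (vderiv p - mu%:P *: p) t).
Proof.
move=> ts.
have H i : exists dg : R -> R, (\forall t \near +oo,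
      is_derive t (1 : R) (fun s => vterm l ph mu p s i 0) (dg t)) /\
    forall a, decays_gt l a (fun t => dg t -
      ((e + e2 * expR (- l t)) *: vterm l ph mu (vderiv p - mu%:P *: p) t) i 0).
  have [dg Hd HO] := time_scale_term_derive mu (p i 0) ts.
  exists dg; split.
    near=> t.
    have -> : (fun s => vterm l ph mu p s i 0) =
       fun s => expR (- (mu * l s)) * (p i 0).[ph s].
      by apply/funext => s; rewrite !mxE.
    by near: t.
  move=> a; apply: decays_gt_near (HO a); near=> t.
  by rewrite !mxE mul_polyC.
have /choice[dg Hdg] := H.
exists (fun t => \col_i dg i t).
  apply: filter_forall => i; near=> t; rewrite mxE.
  by near: t; exact: (Hdg i).1.
move=> a i; apply: decays_gt_near ((Hdg i).2 a); near=> t.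
by rewrite !mxE.
Unshelve. all: by end_near. Qed.

End VectorPolynomials.

(** Each term has to be chosen according to the previous ones: in the equations
    of the coefficients, the integration constants depend on the solution and
    on the terms already subtracted. *)
Lemma dependent_sequence (T : Type) (x0 : T) (P : nat -> (nat -> T) -> Prop) :
  (forall N q q', (forall k, (k < N)%N -> q k = q' k) -> P N q -> P N q') ->
  (forall q, P 0%N q) ->
  (forall N q, P N q -> exists Q, P N.+1 (fun k => if k == N then Q else q k)) ->
  exists q, forall N, P N q.
Proof.
move=> Ploc P0 PS.
have /choice[s Hs] (Nq : nat * (nat -> T)) : exists Q, P Nq.1 Nq.2 ->
    P Nq.1.+1 (fun k => if k == Nq.1 then Q else Nq.2 k).
  case: (pselect (P Nq.1 Nq.2)) => [/PS[Q HQ]|nP]; first by exists Q.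
  by exists x0.
pose F := fix F N := if N is N'.+1 then
  (fun k => if k == N' then s (N', F N') else F N' k) else fun=> x0.
have PF N : P N (F N) by elim: N => [|N IH]; [exact: P0|exact: (Hs (N, F N))].
have agree N k : (k < N)%N -> F N k = F k.+1 k.
  elim: N => // N IH; rewrite ltnS leq_eqVlt => /orP[/eqP -> //|kN].
  by rewrite -IH //= ltn_eqF.
exists (fun k => F k.+1 k) => N.
by apply: Ploc (PF N) => k; exact: agree.
Qed.

Section Locality.
Variables (R : realType) (n : nat) (mu : nat -> R).
Variable Gml : forall m : nat, {ffun 'I_m -> 'cV[R]_n} -> 'cV[R]_n.
Hypothesis Gml_multilinear : forall m, (2 <= m)%N -> multilinear (@Gml m).
Hypotheses (mu_gt0 : forall k, 0 < mu k) (mu_incr : increasing_seq mu).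

Lemma resonant_order k : exists M, mu k < M.+1%:R * mu 0%N.
Proof.
exists (Num.bound (mu k / mu 0%N)); rewrite -ltr_pdivrMr //.
apply: (@lt_trans _ _ (Num.bound (mu k / mu 0%N))%:R); last by rewrite ltr_nat.
by apply: archi_boundP; rewrite divr_ge0 // ltW.
Qed.

Lemma resonant_sum_local (q q' : nat -> vpoly R n) k z :
  (forall j, (j < k)%N -> q j = q' j) ->
  resonant_sum mu Gml q k z = resonant_sum mu Gml q' k z.
Proof.
move=> qq'; have [M HM] := resonant_order k.
rewrite !(resonant_sum_finite mu_gt0 mu_incr _ _ _ (leqnn k) HM).
apply: eq_bigr => m _; apply: eq_bigr => j _; congr Gml.
by apply/ffunP => i; rewrite !ffunE qq'.
Qed.

Lemma resonant_sum_vpoly (q : nat -> vpoly R n) k :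
  exists r : vpoly R n, forall z, veval r z = resonant_sum mu Gml q k z.
Proof.
have [M HM] := resonant_order k.
have Hm m : (2 <= m < M.+1)%N && true -> exists s : vpoly R n, forall z,
    veval s z = \sum_(j : {ffun 'I_m -> 'I_k} | \sum_i mu (j i) == mu k)
      Gml [ffun i => veval (q (j i)) z].
  move=> /andP[/andP[m2 _] _]; apply: vpoly_sum => j _.
  exact: multilinear_vpoly (Gml_multilinear m2).
have [r Hr] := vpoly_sum (index_iota 2 M.+1) Hm.
exists r => z; rewrite (resonant_sum_finite mu_gt0 mu_incr _ _ _ (leqnn k) HM).
by rewrite Hr -big_nat_cond.
Qed.

Lemma chi_local ty (q q' : nat -> vpoly R n) k :
  (forall j, (j < k)%N -> q j = q' j) -> chi ty mu q k = chi ty mu q' k.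
Proof.
move=> qq'; case: ty => //=.
by case: pickP => // j _; rewrite qq'.
Qed.

(** As a sum, [chi] can be exchanged with the sum over the orders [k]; the common
    range [N] of the indices is harmless, because [mu j + 1 = mu k] forces
    [j < k]. *)
Lemma chi_sum ty (q : nat -> vpoly R n) k N z : (k <= N)%N ->
  veval (chi ty mu q k) z = inv_psi_coef R ty *: \sum_(j < N | mu j + 1 == mu k)
    veval ((mu j)%:P *: q j - vderiv (q j)) z.
Proof.
move=> kN; case: ty => [||ms ns H] /=; rewrite ?scale0r ?veval0 // scale1r.
have lt_of j : mu j + 1 = mu k -> (j < k)%N.
  by move=> jk; rewrite -(mu_lt mu_incr) -jk ltrDl.
case: pickP => [j /eqP jk|none].
  rewrite (big_pred1 (widen_ord kN j)) //= => i.
  apply/eqP/eqP => [|-> //]; rewrite -jk => /addIr /(mu_inj mu_incr) ij.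
  exact: val_inj.
rewrite veval0 big_pred0 // => j; apply/negP => /eqP jk.
by have := none (Ordinal (lt_of _ jk)); rewrite /= jk eqxx.
Qed.

End Locality.

(** * Construction and uniqueness of the expansion *)

Section Expansion.
Variables (R : realType) (n : nat).
Variables (A : 'M[R]_n) (S : 'M[R]_n) (d : 'rV[R]_n).
Hypotheses (Su : S \in unitmx) (AE : A = invmx S *m diag_mx d *m S).
Hypothesis d_gt0 : forall i, 0 < d 0 i.
Variables (G : 'cV[R]_n -> 'cV[R]_n) (Gm : nat -> 'cV[R]_n -> 'cV[R]_n).
Variable Gml : forall m : nat, {ffun 'I_m -> 'cV[R]_n} -> 'cV[R]_n.
Hypothesis G_lip : locally_lipschitz G.
Hypothesis G_exp : power_expansion_at0 G Gm.
Hypothesis Gml_multilinear : forall m, (2 <= m)%N -> multilinear (@Gml m).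
Hypothesis Gml_diag :
  forall m, (2 <= m)%N -> forall y, Gm m y = Gml [ffun i : 'I_m => y].
Variable ty : pair_type.
Variable mu : nat -> R.
Hypotheses (mu_gt0 : forall k, 0 < mu k) (mu_incr : increasing_seq mu).
Hypothesis mu_add : forall x y : R, range mu x -> range mu y -> range mu (x + y).
Hypothesis mu_eigen : ty = Type1 -> forall i, range mu (d 0 i).
Hypothesis mu_add1 : ty = Type2 -> forall x : R, range mu x -> range mu (x + 1).
Variables (f y : R -> 'cV[R]_n) (p : nat -> vpoly R n).

Local Notation l := (@log_psi R ty).
Local Notation ph := (@phi R ty).
Local Notation e := (epsilon R ty).
Local Notation e2 := (inv_psi_coef R ty).

Hypothesis f_exp : forall N : nat, vdecays_gt l (mu N)
  (fun t => f t - \sum_(k < N.+1) vterm l ph (mu k) (p k) t).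
Hypothesis y_der : \forall t \near +oo, forall i, is_derive t (1 : R)
  (fun s => y s i 0) ((- (A *m y t) + (G (y t) + f t)) i 0).
Hypothesis y_lim : y t @[t --> +oo] --> (0 : 'cV[R]_n).

Let ts : time_scale l ph e e2 := time_scale_pair R ty.
Let ly : l t @[t --> +oo] --> +oo := ts_lam ts.

(** When [psi] is the exponential, all eigenvalues are exponents, hence at least
    [mu 0], and [mu 0] serves as lower bound [dm] of the eigenvalues. *)
Lemma solution_decay : vdecays_ge l (mu 0%N) y.
Proof.
have [dm [dm0 dmd dmmu]] :
    exists dm, [/\ 0 < dm, forall i, dm <= d 0 i & e * mu 0%N <= dm].
  have [t1|nt1] := pselect (ty = Type1).
    exists (mu 0%N); split=> //; last by rewrite /epsilon t1 mul1r.
    by move=> i; have [k _ <-] := mu_eigen t1 i; rewrite mu_le.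
  have e0 : e = 0 by rewrite /epsilon; case: ty nt1.
  have D0 : 0 < 1 + \sum_i (d 0 i)^-1.
    by rewrite ltr_pwDl // sumr_ge0 // => i _; rewrite invr_ge0 ltW.
  exists (1 + \sum_i (d 0 i)^-1)^-1; split; rewrite ?e0 ?mul0r ?invr_gt0 //.
    move=> i; rewrite invf_ple ?posrE // (bigD1 i) //= addrCA lerDl.
    by rewrite addr_ge0 // sumr_ge0 // => j _; rewrite invr_ge0 ltW.
  by rewrite invr_ge0 ltW.
apply: (@initial_decay R n l ph e e2 (mu 0%N) dm ts S A d Su AE dm0 dmd dmmu
  y (fun t => G (y t)) f) => //.
- exact: vnorm1_cvg0.
- exact: (G_quadratic G_lip G_exp Gml_multilinear Gml_diag y_lim).
move=> i; have h1 := decays_gt_ge ly (f_exp 0 i).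
have := decays_geD h1 (vterm_decay (p 0%N) ts i).
by apply: decays_ge_near; near=> t; rewrite big_ord1 !mxE subrK.
Unshelve. all: by end_near. Qed.

(** The terms of order [mu j + 1] in the derivative of the partial sum: as
    [mu j + 1] is an exponent, each of them is either one of the orders up to
    [N], and contributes to [chi], or is negligible. *)
Lemma shifted_term_expansion (W : nat -> vpoly R n) N :
  ty = Type2 ->
  vdecays_gt l (mu N) (fun t =>
    \sum_(j < N) expR (- l t) *: vterm l ph (mu j) (W j) t -
    \sum_(k < N.+1) expR (- (mu k * l t)) *:
       \sum_(j < N | mu j + 1 == mu k) veval (W j) (ph t)).
Proof.
move=> t2.
have H (j : 'I_N) : vdecays_gt l (mu N) (fun t =>
    expR (- l t) *: vterm l ph (mu j) (W j) t -
    \sum_(k < N.+1 | mu j + 1 == mu k)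
       expR (- (mu k * l t)) *: veval (W j) (ph t)).
  have [|k0 _ k0E] := mu_add1 t2 (x := mu j); first by exists j.
  have E t : expR (- l t) *: vterm l ph (mu j) (W j) t =
      vterm l ph (mu k0) (W j) t.
    by rewrite /vterm scalerA -expRD k0E; congr (expR _ *: _); ring.
  have [k0N|Nk0] := ltnP k0 N.+1.
    apply: vdecays_gt_near (vdecays_gt0 l _); near=> t.
    rewrite (big_pred1 (Ordinal k0N)) /=; last first.
      move=> k; rewrite -k0E; apply/eqP/eqP => [/(mu_inj mu_incr) k0k|-> //].
      exact: val_inj.
    by rewrite E subrr.
  have := vdecays_ge_gt _ (vterm_decay (mu := mu k0) (W j) ts).
  move=> /(_ (mu N)); rewrite mu_lt // => /(_ Nk0).
  apply: vdecays_gt_near; near=> t.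
  rewrite big_pred0 ?subr0 ?E // => k; rewrite -k0E.
  apply/eqP => /(mu_inj mu_incr) k0k.
  by move: Nk0; rewrite k0k ltnNge -ltnS ltn_ord.
have := vdecays_gt_sum ly (index_enum 'I_N) (P := xpredT) (fun j _ => H j).
apply: vdecays_gt_near; near=> t.
rewrite sumrB; congr (_ - _); rewrite (exchange_big_dep xpredT) //=.
by apply: eq_bigr => k _; rewrite scaler_sumr.
Unshelve. all: by end_near. Qed.

Definition solves_equation (q : nat -> vpoly R n) (k : nat) := forall z : R,
  A *m veval (q k) z + e *: (veval (vderiv (q k)) z - mu k *: veval (q k) z) =
  resonant_sum mu Gml q k z + veval (p k) z + veval (chi ty mu q k) z.

Definition expansion_upto (N : nat) (q : nat -> vpoly R n) :=
  (forall k, (k < N)%N -> solves_equation q k) /\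
  remainder_class mu l N (fun t => y t - \sum_(k < N) vterm l ph (mu k) (q k) t).

Lemma solves_equation_local q q' k : (forall j, (j <= k)%N -> q j = q' j) ->
  solves_equation q k -> solves_equation q' k.
Proof.
move=> qq' H z; rewrite -qq' // H.
have lt_eq j : (j < k)%N -> q j = q' j by move=> /ltnW; exact: qq'.
by rewrite (resonant_sum_local Gml mu_gt0 mu_incr _ lt_eq) (chi_local mu ty lt_eq).
Qed.

Lemma expansion_upto_local N q q' : (forall k, (k < N)%N -> q k = q' k) ->
  expansion_upto N q -> expansion_upto N q'.
Proof.
move=> qq' [Hq Hv]; split.
  move=> k kN; apply: solves_equation_local (Hq k kN) => j jk.
  by apply: qq'; exact: leq_ltn_trans kN.
suff <- : (fun t => y t - \sum_(k < N) vterm l ph (mu k) (q k) t) =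
  (fun t => y t - \sum_(k < N) vterm l ph (mu k) (q' k) t) by [].
apply/funext => t; congr (_ - _); apply: eq_bigr => k _.
by rewrite qq'.
Qed.

(** The remainder [v] after [N] terms solves [v' = - A v + h]. The equations of
    the orders below [N] cancel all terms of [h] up to the exponent [mu N],
    where the right-hand side of the [N]th equation is left. *)
Lemma remainder_forcing N q : expansion_upto N q ->
  exists2 h : R -> 'cV[R]_n,
    \forall t \near +oo, forall i, is_derive t (1 : R)
      (fun s => (y s - \sum_(k < N) vterm l ph (mu k) (q k) s) i 0)
      ((- (A *m (y t - \sum_(k < N) vterm l ph (mu k) (q k) t)) + h t) i 0) &
    vdecays_gt l (mu N) (fun t => h t - expR (- (mu N * l t)) *:
      (resonant_sum mu Gml q N (ph t) + veval (p N) (ph t) +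
       veval (chi ty mu q N) (ph t))).
Proof.
move=> [Hq Hv].
have /choice[dg Hdg] : forall k, exists dg : R -> 'cV[R]_n,
    (\forall t \near +oo, forall i,
      is_derive t (1 : R) (fun s => vterm l ph (mu k) (q k) s i 0) (dg t i 0)) /\
    forall a, vdecays_gt l a (fun t => dg t - (e + e2 * expR (- l t)) *:
      vterm l ph (mu k) (vderiv (q k) - (mu k)%:P *: q k) t).
  by move=> k; have [dg h1 h2] := vterm_derive (mu k) (q k) ts; exists dg.
pose Y t := \sum_(k < N) vterm l ph (mu k) (q k) t.
exists (fun t => - (A *m Y t) + G (y t) + f t - \sum_(k < N) dg k t).
  have Hd : \forall t \near +oo, forall k : 'I_N, forall i,
      is_derive t (1 : R) (fun s => vterm l ph (mu k) (q k) s i 0) (dg k t i 0).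
    by apply: filter_forall => k; exact: (Hdg k).1.
  near=> t => i.
  have Hdt : forall k : 'I_N, forall i,
      is_derive t (1 : R) (fun s => vterm l ph (mu k) (q k) s i 0) (dg k t i 0).
    by near: t.
  have Hyt : forall i, is_derive t (1 : R)
      (fun s => y s i 0) ((- (A *m y t) + (G (y t) + f t)) i 0) by near: t.
  have -> : (- (A *m (y t - Y t)) + (- (A *m Y t) + G (y t) + f t -
      \sum_(k < N) dg k t)) i 0 =
      (- (A *m y t) + (G (y t) + f t)) i 0 - \sum_(k < N) dg k t i 0.
    by rewrite mulmxBr !mxE summxE; ring.
  have -> : (fun s => (y s - Y s) i 0) =
      fun s => y s i 0 - \sum_(k < N) vterm l ph (mu k) (q k) s i 0.
    by apply/funext => s; rewrite !mxE summxE.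
  apply: is_derive_sub => //.
  by apply: is_derive_lsum => k.
have GO := nonlinear_expansion G_lip G_exp Gml_multilinear Gml_diag mu_gt0
  mu_incr mu_add ts Hv (vnorm1_cvg0 y_lim).
have dO := vdecays_gt_sum ly (index_enum 'I_N) (P := xpredT)
  (fun k _ => (Hdg k).2 (mu N)).
pose W k := (mu k)%:P *: q k - vderiv (q k).
have chiO : vdecays_gt l (mu N) (fun t =>
    e2 *: \sum_(j < N) expR (- l t) *: vterm l ph (mu j) (W j) t -
    \sum_(k < N.+1) expR (- (mu k * l t)) *: veval (chi ty mu q k) (ph t)).
  have H0 : ty <> Type2 -> e2 = 0 by case: ty.
  have E t : \sum_(k < N.+1) expR (- (mu k * l t)) *: veval (chi ty mu q k) (ph t)
    = e2 *: \sum_(k < N.+1) expR (- (mu k * l t)) *: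
       \sum_(j < N | mu j + 1 == mu k) veval (W j) (ph t).
    rewrite scaler_sumr; apply: eq_bigr => k _.
    by rewrite (@chi_sum _ _ _ mu_incr _ _ _ N) ?scalerA 1?mulrC // -ltnS.
  have [t2|nt2] := pselect (ty = Type2).
    apply: vdecays_gt_near (shifted_term_expansion W N t2); near=> t.
    by rewrite E [inv_psi_coef _ _](_ : _ = 1) ?scale1r // t2.
  apply: vdecays_gt_near (vdecays_gt0 l _); near=> t.
  by rewrite E H0 // !scale0r subrr.
have := vdecays_gtB ly (vdecays_gtD ly (vdecays_gtD ly GO (f_exp N)) chiO) dO.
apply: vdecays_gt_near; near=> t.
rewrite sumrB !big_ord_recr /=.
have Eq : \sum_(k < N) expR (- (mu k * l t)) *: resonant_sum mu Gml q k (ph t) +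
    \sum_(k < N) vterm l ph (mu k) (p k) t +
    \sum_(k < N) expR (- (mu k * l t)) *: veval (chi ty mu q k) (ph t) =
    A *m Y t + e *: \sum_(k < N) vterm l ph (mu k) (- W k) t.
  rewrite -!big_split /= mulmx_sumr scaler_sumr -big_split /=.
  apply: eq_bigr => k _; rewrite /vterm -!scalerDr -Hq // -scalemxAr scalerDr.
  congr (_ + _); rewrite !scalerA mulrC; congr (_ *: _).
  by rewrite opprB vevalB vevalZ.
have -> : \sum_(k < N) (e + e2 * expR (- l t)) *:
      vterm l ph (mu k) (vderiv (q k) - (mu k)%:P *: q k) t =
   e *: \sum_(k < N) vterm l ph (mu k) (- W k) t -
   e2 *: \sum_(k < N) expR (- l t) *: vterm l ph (mu k) (W k) t.
  rewrite !scaler_sumr -sumrB; apply: eq_bigr => k _.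
  rewrite scalerDl scalerA -/(W k) opprB; congr (_ + _).
  rewrite -[RHS]scalerN; congr (_ *: _).
  by rewrite /vterm -[RHS]scalerN /W !vevalB opprB.
move: Eq => /(canRL (addrK _))/(canRL (addrK _)) ->.
rewrite /vterm !scalerDr.
move: (e *: _) (e2 *: _) (\sum_(i < N) dg i t) => a b c.
by apply/matrixP => i j; rewrite !mxE; ring.
Unshelve. all: by end_near. Qed.

(** In the coordinates which diagonalize [A], the equation of the remainder
    splits into scalar ones. An eigenvalue smaller than [mu N] is some [mu k]
    with [k < N], so the remainder is already known to decay faster than the
    corresponding solution of the homogeneous equation. *)
Lemma expansion_step N q : expansion_upto N q ->
  exists Q, expansion_upto N.+1 (fun k => if k == N then Q else q k).
Proof.
move=> Hup; have [Hq Hv] := Hup.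
have [h hd hO] := remainder_forcing Hup.
set v := fun t => y t - \sum_(k < N) vterm l ph (mu k) (q k) t in Hv hd.
have [r Hr] := resonant_sum_vpoly Gml_multilinear mu_gt0 mu_incr q N.
pose P : vpoly R n := r + p N + chi ty mu q N.
have PE z : veval P z = resonant_sum mu Gml q N z + veval (p N) z +
    veval (chi ty mu q N) z by rewrite /P !vevalD Hr.
pose SP := cmulmx S P.
have Hi i : exists2 Q : {poly R},
    d 0 i *: Q + e *: (Q^`() - mu N *: Q) = SP i 0 &
    decays_gt l (mu N)
      (fun t => (S *m v t) i 0 - expR (- (mu N * l t)) * Q.[ph t]).
  apply: (@scalar_linear_step R l ph e e2 (d 0 i) (mu N) _
    (fun t => (S *m h t) i 0) _ ts (d_gt0 i)).
  - near=> t; rewrite -(mulmx_diagonalized _ _ _ Su AE).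
    by apply: is_derive_mulmx; near: t.
  - apply: decays_gt_near (vdecays_gt_mulmx ly S hO i); near=> t.
    rewrite -PE mulmxBr -scalemxAr -veval_cmulmx.
    by rewrite !mxE.
  - move=> e1 dmu.
    have t1 : ty = Type1.
      move: e1; rewrite /epsilon.
      by case: (ty) => [//|/eqP|ms ns H /eqP]; rewrite eq_sym oner_eq0.
    have [k _ kE] := mu_eigen t1 i.
    have kN : (k < N)%N by rewrite -(mu_lt mu_incr) kE.
    move: Hv kN; case: (N) => // N' /= Hv kN.
    apply: (@decays_gt_weaken _ _ _ (mu N')).
      by rewrite -kE mu_le.
    exact: (vdecays_gt_mulmx ly S Hv i).
have /choice[Qs HQs] : forall i, exists Q : {poly R},
    d 0 i *: Q + e *: (Q^`() - mu N *: Q) = SP i 0 /\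
    decays_gt l (mu N)
      (fun t => (S *m v t) i 0 - expR (- (mu N * l t)) * Q.[ph t]).
  by move=> i; have [Q ? ?] := Hi i; exists Q.
pose U : vpoly R n := \col_i Qs i.
pose Q := cmulmx (invmx S) U.
have Qeq z : A *m veval Q z + e *: (veval (vderiv Q) z - mu N *: veval Q z) =
    veval P z.
  rewrite /Q vderiv_cmulmx !veval_cmulmx AE !mulmxA mulmxK // -mulmxA.
  rewrite scalemxAr -mulmxBr scalemxAr -mulmxDr.
  have -> : veval P z = invmx S *m veval SP z by rewrite veval_cmulmx mulKmx.
  congr (_ *m _); apply/matrixP => i j; rewrite ord1.
  have := congr1 (fun X => X.[z]) (HQs i).1.
  rewrite !(hornerD, hornerZ, hornerN) => HH.
  by rewrite [RHS]mxE -HH mul_diag_mx !mxE.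
exists Q; split.
  move=> k; rewrite ltnS leq_eqVlt => /orP[/eqP ->|kN].
    apply: (@solves_equation_local (fun k => if k == N then Q else q k)) => // z.
    rewrite eqxx Qeq PE.
    have lt_eq j : (j < N)%N -> q j = (if j == N then Q else q j).
      by move=> jN; rewrite ltn_eqF.
    by rewrite (resonant_sum_local Gml mu_gt0 mu_incr _ lt_eq) (chi_local mu ty lt_eq).
  apply: solves_equation_local (Hq k kN) => j jk.
  by rewrite ltn_eqF // (leq_ltn_trans jk).
have UO : vdecays_gt l (mu N) (fun t =>
    S *m v t - expR (- (mu N * l t)) *: veval U (ph t)).
  move=> i; apply: decays_gt_near (HQs i).2; near=> t.
  by rewrite [RHS]mxE; congr (_ + _); rewrite !mxE.
have := vdecays_gt_mulmx ly (invmx S) UO.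
apply: vdecays_gt_near; near=> t.
rewrite mulmxBr mulKmx // -scalemxAr -veval_cmulmx -/Q /v.
rewrite big_ord_recr /= eqxx opprD addrA; congr (_ - _ - _).
by apply: eq_bigr => k _; rewrite ltn_eqF.
Unshelve. all: by end_near. Qed.

Lemma expansion_exists : exists q, forall N, expansion_upto N q.
Proof.
apply: (dependent_sequence 0); first exact: expansion_upto_local.
  move=> q; split=> //= i; have := solution_decay i.
  by apply: decays_ge_near; near=> t; rewrite big_ord0 subr0.
exact: expansion_step.
Unshelve. all: by end_near. Qed.

End Expansion.

(** The first pair of distinct coefficients would differ by a nonzero polynomial
    in [phi] which tends to zero. *)
Lemma expansion_unique (R : realType) (n : nat) ty (mu : nat -> R)
    (y : R -> 'cV[R]_n) (q q' : nat -> vpoly R n) :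
  asymp_expansion y q mu (phi ty) (psi ty) ->
  asymp_expansion y q' mu (phi ty) (psi ty) -> forall k, q' k = q k.
Proof.
move=> /asymp_expansionP Hq /asymp_expansionP Hq' k.
have ts := time_scale_pair R ty; have ly := ts_lam ts.
elim/ltn_ind: k => k IH; apply/matrixP => i j; rewrite ord1.
apply/eqP; rewrite -subr_eq0; apply/eqP.
apply: (poly_vanishing (ts_phi ts)).
have growth : decays (log_psi ty) (- mu k) (fun t => expR (mu k * log_psi ty t)).
  by exists 1; near=> t; rewrite mul1r mulNr opprK ger0_norm ?expR_ge0.
have [nu knu /(decaysM growth) H] := vdecays_gtB ly (Hq k) (Hq' k) i.
apply: (@decays_cvg0 _ _ ly (- mu k + nu)); first by rewrite addrC subr_gt0.
apply: decays_near H; near=> t.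
have E : expR (mu k * log_psi ty t) * expR (- (mu k * log_psi ty t)) = 1.
  by rewrite expRxMexpNx_1.
rewrite !big_ord_recr /=.
have -> : \sum_(j < k) vterm (log_psi ty) (phi ty) (mu j) (q' j) t =
    \sum_(j < k) vterm (log_psi ty) (phi ty) (mu j) (q j) t.
  by apply: eq_bigr => j' _; rewrite IH.
rewrite !mxE hornerD hornerN.
by rewrite -[RHS]mul1r -E; ring.
Unshelve. all: by end_near. Qed.

Lemma diagonal_eigenvalue (F : fieldType) n (A S : 'M[F]_n) (d : 'rV[F]_n) i :
  S \in unitmx -> A = invmx S *m diag_mx d *m S -> eigenvalue A (d 0 i).
Proof.
move=> Su AE; apply/eigenvalueP; exists (row i S).
  rewrite -row_mul AE !mulmxA mulmxV // mul1mx row_mul row_diag_mx.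
  by rewrite -scalemxAl -rowE.
apply/eqP => S0; have : row i S *m invmx S = 0 by rewrite S0 mul0mx.
rewrite -row_mul mulmxV // row1 => /matrixP/(_ 0 i).
by rewrite !mxE !eqxx => /eqP; rewrite oner_eq0.
Qed.

Theorem theorem4p10 (R : realType) (n : nat) (n_gt0 : (0 < n)%N)
  (A : 'M[R]_n) (A_diag : diag_pos_eigen A)
  (G : 'cV[R]_n -> 'cV[R]_n) (G_lip : locally_lipschitz G)
  (Gm : nat -> 'cV[R]_n -> 'cV[R]_n)
  (Gm_homog : forall m, (2 <= m)%N -> homog_poly_map m (Gm m))
  (G_exp : power_expansion_at0 G Gm)
  (Gml : forall m : nat, {ffun 'I_m -> 'cV[R]_n} -> 'cV[R]_n)
  (Gml_multilinear : forall m, (2 <= m)%N -> multilinear (Gml m))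
  (Gml_diag : forall m, (2 <= m)%N -> forall y, Gm m y = Gml m [ffun=> y])
  (ty : pair_type)
  (f : R -> 'cV[R]_n)
  (Tf : R) (Tf_ge0 : 0 <= Tf) (f_cont : {within `[Tf, +oo[, continuous f})
  (mu : nat -> R) (mu_gt0 : forall k, 0 < mu k)
  (mu_incr : increasing_seq mu) (mu_div : mu k @[k --> \oo] --> +oo)
  (p : nat -> vpoly R n)
  (f_exp : asymp_expansion f p mu (phi ty) (psi ty))
  (mu_add : forall x y : R, range mu x -> range mu y -> range mu (x + y))
  (mu_eigen : ty = Type1 -> forall a : R, eigenvalue A a -> range mu a)
  (mu_add1 : ty = Type2 -> forall x : R, range mu x -> range mu (x + 1))
  (T0 : R) (T0_ge0 : 0 <= T0)
  (y : R -> 'cV[R]_n) (y_C1 : C1_on y `]T0, +oo[)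
  (y_sol : forall t, T0 < t -> derive1 y t = - (A *m y t) + G (y t) + f t)
  (y_lim : y t @[t --> +oo] --> (0 : 'cV[R]_n)) :
  exists q : nat -> vpoly R n,
    [/\ asymp_expansion y q mu (phi ty) (psi ty),
        (forall q' : nat -> vpoly R n,
           asymp_expansion y q' mu (phi ty) (psi ty) -> forall k, q' k = q k),
        (forall z : R,
           A *m veval (q 0%N) z
           + epsilon R ty *: (veval (vderiv (q 0%N)) z
                              - mu 0%N *: veval (q 0%N) z)
           = veval (p 0%N) z) &
        (forall (k : nat) (z : R), (1 <= k)%N ->
           A *m veval (q k) z
           + epsilon R ty *: (veval (vderiv (q k)) z - mu k *: veval (q k) z)
           = resonant_sum mu Gml q k z + veval (p k) z
             + veval (chi ty mu q k) z)].
Proof.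
have [S [d [Su d0 AE]]] := A_diag.
have y_der : \forall t \near +oo, forall i, is_derive t (1 : R)
    (fun s => y s i 0) ((- (A *m y t) + (G (y t) + f t)) i 0).
  near=> t => i.
  have t0 : T0 < t by near: t; apply: nbhs_pinfty_gt; exact: num_real.
  rewrite addrA -y_sol //; apply: is_derive_entry.
  have t_itv : `]T0, +oo[%classic t by rewrite /= in_itv /= t0.
  exact: (y_C1 t t_itv).1.
have f_exp' := (asymp_expansionP ty f p mu).1 f_exp.
have mu_eig : ty = Type1 -> forall i, range mu (d 0 i).
  by move=> t1 i; apply: mu_eigen => //; exact: diagonal_eigenvalue AE.
have [q Hq] := expansion_exists Su AE d0 G_lip G_exp Gml_multilinear Gml_diag
  mu_gt0 mu_incr mu_add mu_eig mu_add1 f_exp' y_der y_lim.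
have q_exp : asymp_expansion y q mu (phi ty) (psi ty).
  by apply/asymp_expansionP => N; exact: (Hq N.+1).2.
have q_eq k : solves_equation A Gml ty mu p q k by exact: (Hq k.+1).1.
exists q; split => //.
- by move=> q' q'_exp; exact: expansion_unique q_exp q'_exp.
- move=> z; rewrite q_eq.
  (* No index precedes 0, so the resonant sum and chi vanish at order 0. *)
  have [M HM] := resonant_order mu_gt0 0.
  rewrite (resonant_sum_finite mu_gt0 mu_incr Gml q z (leqnn 0) HM).
  rewrite big_nat big1 => [|m /andP[m2 _]]; last first.
    rewrite big1 // => j _; have m0 : (0 < m)%N by exact: ltn_trans m2.
    by have := ltn_ord (j (Ordinal m0)).
  rewrite (@chi_sum _ _ _ mu_incr _ _ _ 0) // big_ord0 scaler0.
  by rewrite add0r addr0.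
- by move=> k z _; exact: q_eq.
Unshelve. all: by end_near. Qed.
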